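(* Let $\mathbf{a}=(a_1,\dots,a_n)\in\mathbb{R}^n$ and let $\mathcal{L}\subset\mathbb{R}^n$ be the hyperplane which is the image of the map $$(x_1,\dots,x_{n-1})\mapsto (a_1x_1+\dots+a_{n-1}x_{n-1}+a_n,\,x_1,\dots,x_{n-1}).$$ Let $s$ be such that $s-1$ equals the number of nonzero elements among $a_1,\dots,a_{n-1}$. Then $$\omega^\times(\mathcal{L})=\max\left(n,\ \frac{n}{s}\,\sigma(\mathbf{a})\right).$$
   Context: For $\mathbf{y}\in\mathbb{R}^n$, $\Pi_+(\mathbf{y})=\prod_{i=1}^n\max(1,|y_i|)$ and $\omega^\times(\mathbf{y})=\sup\{v\mid$ there are infinitely many $\mathbf{q}\in\mathbb{Z}^n$ with $|\langle\mathbf{q},\mathbf{y}\rangle+p|<\Pi_+(\mathbf{q})^{-v/n}$ for some $p\in\mathbb{Z}\}$. For a Borel measure $\mu$, $\omega^\times(\mu)=\sup\{v\mid\mu\{\mathbf{y}\mid\omega^\times(\mathbf{y})>v\}>0\}$, and $\omega^\times(\mathcal{L})$ is $\omega^\times$ of the Lebesgue measure class on $\mathcal{L}$ (pushforward of Lebesgue measure under an affine parametrization). For $\mathbf{a}\in\mathbb{R}^n$, $$\sigma(\mathbf{a})=\sup\{v\mid\text{there are infinitely many }q\in\mathbb{Z}\text{ with }\|q\mathbf{a}+\mathbf{p}\|<|q|^{-v}\text{ for some }\mathbf{p}\in\mathbb{Z}^n\},$$ where $\|\cdot\|$ is any norm on $\mathbb{R}^n$. *)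

(* Defs.v *)
From HB Require Import structures.
From mathcomp Require Import all_boot all_order all_algebra.
From mathcomp Require Import all_classical all_reals all_analysis.
From mathcomp Require Import measurable_realfun.
Import Order.TTheory GRing.Theory Num.Theory.
Import numFieldNormedType.Exports.

Set Implicit Arguments.
Unset Strict Implicit.
Unset Printing Implicit Defensive.

Local Open Scope classical_set_scope.
Local Open Scope ring_scope.

(* The sigma-algebra of Rn R n, generated by the coordinates, is the Borel
   sigma-algebra of R^n. *)
Notation Rn R n := (n.-tuple (measurableTypeR R)).

Section lebesgue_cons.
Context (R : realType) (m : nat).
Variable mu : {sigma_finite_measure set (Rn R m) -> \bar R}.

Definition cons_pair (xt : measurableTypeR R * Rn R m) : Rn R m.+1 :=
  [tuple of xt.1 :: xt.2].

Lemma measurable_cons_pair :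
  measurable_fun [set: measurableTypeR R * Rn R m] cons_pair.
Proof. exact: measurable_cons. Qed.

Definition lebesgue_cons : set (Rn R m.+1) -> \bar R :=
  pushforward (lebesgue_measure \x mu)%E cons_pair.

HB.instance Definition _ := Measure.copy lebesgue_cons
  (measure_function_pushforward__canonical__measure_function_Measure
     (lebesgue_measure \x mu)%E measurable_cons_pair).

Lemma lebesgue_cons_sigma_finite : sigma_finite setT lebesgue_cons.
Proof.
have /sigma_finiteP[F [FT ndF Ffin]] :=
  @sigma_finiteT _ _ R (@lebesgue_measure R).
have /sigma_finiteP[G [GT ndG Gfin]] := sigma_finiteT mu.
pose split_tuple (t : Rn R m.+1) : measurableTypeR R * Rn R m :=
  (tnth t ord0, [tuple of behead t]).
have splitK xt : split_tuple (cons_pair xt) = xt.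
  by case: xt => x t; congr pair; apply: val_inj.
have msplit : measurable_fun setT split_tuple.
  by apply/measurable_fun_pairP; split;
    [exact: measurable_tnth|exact: measurable_behead].
exists (fun k => split_tuple @^-1` (F k `*` G k)).
  apply/esym; rewrite -subTset => t _.
  have [i _ Fi] : (\bigcup_i F i) (tnth t ord0) by rewrite -FT.
  have [j _ Gj] : (\bigcup_i G i) [tuple of behead t] by rewrite -GT.
  exists (maxn i j) => //; split => /=.
    by move: Fi; exact/subsetPset/ndF/leq_maxl.
  by move: Gj; exact/subsetPset/ndG/leq_maxr.
move=> k; have [mF Fy] := Ffin k; have [mG Gy] := Gfin k; split.
  by rewrite -[X in measurable X]setTI; apply: msplit => //; exact: measurableX.
rewrite /lebesgue_cons /pushforward -comp_preimage.
rewrite (_ : _ \o _ = id); last by apply/funext => xt /=; rewrite splitK.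
by rewrite preimage_id product_measure1E // lte_mul_pinfty // ge0_fin_numE.
Qed.

HB.instance Definition _ := Measure_isSigmaFinite.Build _ _ _
  lebesgue_cons lebesgue_cons_sigma_finite.

End lebesgue_cons.

(* Lebesgue measure on R^m; on R^0 it is the unit mass at the only point. *)
Fixpoint lebesgue_Rn (R : realType) (m : nat) :
    {sigma_finite_measure set (Rn R m) -> \bar R} :=
  match m with
  | 0 => dirac ([tuple] : Rn R 0)
  | m'.+1 => lebesgue_cons (lebesgue_Rn R m')
  end.

Lemma lebesgue_Rn_box (R : realType) (m : nat)
    (A : 'I_m -> set (measurableTypeR R)) : (forall i, measurable (A i)) ->
  lebesgue_Rn R m [set x | forall i, A i (tnth x i)] =
    (\prod_(i < m) lebesgue_measure (A i))%E.
Proof.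
elim: m A => [|m IHm] A mA.
  by rewrite big_ord0 /= diracE mem_set // => -[].
rewrite big_ord_recl -IHm // -product_measure1E //.
  congr (product_measure1 _ _ _); apply/seteqP; split => -[x t] /=.
    move=> At; split; first exact: (At ord0).
    by move=> i; have := At (lift ord0 i); rewrite tnthS.
  move=> [Ax At] i; have [->//|[j ->]] : i = ord0 \/ exists j, i = lift ord0 j.
    by case: (unliftP ord0 i) => [j ->|->]; [right; exists j|left].
  by rewrite tnthS; exact: At.
rewrite [X in measurable X](_ : _ =
    \bigcap_(i in [set: 'I_m]) (fun t : Rn R m => tnth t i) @^-1` A (lift ord0 i)).
  apply: fin_bigcap_measurable => // i _.
  by rewrite -[X in measurable X]setTI; exact: measurable_tnth.
by apply/seteqP; split => t At i => [_|]; exact: At.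
Qed.

Section exponents.
Context (R : realType) (n : nat).

Definition Pi_plus (y : n.-tuple R) : R := \prod_(i < n) Num.max 1 `|tnth y i|.

Definition int_vec (q : n.-tuple int) : n.-tuple R :=
  [tuple (tnth q i)%:~R | i < n].

Definition dotR (x y : n.-tuple R) : R := \sum_(i < n) tnth x i * tnth y i.

(* All the suprema below are taken in the extended reals: +oo is a possible
   value. *)
Definition mult_exponent (y : n.-tuple R) : \bar R :=
  ereal_sup [set v%:E | v in [set v : R |
    infinite_set [set q : n.-tuple int | exists p : int,
      `|dotR (int_vec q) y + p%:~R| < Pi_plus (int_vec q) `^ (- (v / n%:R))]]].

Definition mult_exponent_measure
    (mu : {measure set (Rn R n) -> \bar R}) : \bar R :=
  ereal_sup [set v%:E | v in [set v : R |
    (0 < mu [set y | v%:E < mult_exponent y])%E]].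

Record is_norm (N : 'rV[R]_n -> R) : Prop := IsNorm {
  is_normD : forall x y, N (x + y) <= N x + N y ;
  is_normZ : forall (c : R) x, N (c *: x) = `|c| * N x ;
  is_norm0_eq0 : forall x, N x = 0 -> x = 0 }.

Definition simult_exponent (N : 'rV[R]_n -> R) (a : n.-tuple R) : \bar R :=
  ereal_sup [set v%:E | v in [set v : R |
    infinite_set [set q : int | exists p : n.-tuple int,
      N (\row_i (q%:~R * tnth a i + (tnth p i)%:~R)) < `|q%:~R| `^ (- v)]]].

End exponents.

(* With n = m.+1, the coefficients a_1, ..., a_(n-1) are the first m entries
   of a, and a_n is the last one. *)
Section hyperplane.
Context (R : realType) (m : nat) (a : m.+1.-tuple R).

Definition linear_coef (i : 'I_m) : R := tnth a (widen_ord (leqnSn m) i).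

Definition hyperplane_param (x : Rn R m) : Rn R m.+1 :=
  [tuple of (\sum_(i < m) linear_coef i * tnth x i + tnth a ord_max) :: x].

Lemma measurable_hyperplane_param : measurable_fun setT hyperplane_param.
Proof.
apply: measurable_cons => //.
apply: (@measurable_funD _ (Rn R m) R) => //.
apply: (@measurable_sum _ (Rn R m) R) => i.
apply: (@measurable_funM _ (Rn R m) R) => //.
exact: measurable_tnth.
Qed.

Definition hyperplane_lebesgue : {measure set (Rn R m.+1) -> \bar R} :=
  measure_function_pushforward__canonical__measure_function_Measure
    (lebesgue_Rn R m) measurable_hyperplane_param.

Definition hyperplane_mult_exponent : \bar R :=
  mult_exponent_measure hyperplane_lebesgue.

End hyperplane.

(* Main.v *)
Require Import Defs.
From mathcomp Require Import all_boot all_order all_algebra.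
From mathcomp Require Import all_classical all_reals all_analysis.
From mathcomp Require Import measurable_realfun ring lra zify.
Import Order.TTheory GRing.Theory Num.Theory.
Import numFieldNormedType.Exports.

(* Write y = (a' x + a_n, x) for a point of the hyperplane and q = (q_0, q').
   Then <q, y> + p is the affine form in x with linear coefficients
   q_0 a_j + q_j and constant term q_0 a_n + p.

   Lower bound: Dirichlet's pigeonhole principle gives n for every y, and a good
   simultaneous approximation (q_0, p) of a gives a small form with
   Pi_+(q) of order at most |q_0|^s, since q_j = 0 whenever a_j = 0.

   Upper bound: by Borel-Cantelli in a box, with w = v / n > 1 and w s > sigma(a).
   The set of x at which the form of q is within Pi_+(q)^(-w) of an integer has
   measure of order Pi_+(q)^(-w) (1 + 1 / c), where c is the size of the linear
   coefficients.  If c >= 1/2, the sum over q converges because w > 1.  If c < 1/2,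
   then q is determined by q_0 and Pi_+(q) is at least of order |q_0|^s; when
   moreover c is at least of order 1 / |q_0|, then s >= 2 and the sum over q_0 is
   dominated by that of |q_0|^(1 - w s).  The remaining q with
   2^k <= |q_0| < 2^(k+1) are all proportional, so their strips lie in a single
   one, whose width is controlled by sigma(a); the sum over k is geometric. *)

Set Implicit Arguments.
Unset Strict Implicit.
Unset Printing Implicit Defensive.

Local Open Scope classical_set_scope.
Local Open Scope ring_scope.

(** * Sums bounded uniformly over finite families *)

Section uniform_sums.
Context (R : realType).

(** Convergence of a nonnegative series, expressed by one bound on all its finite subsums. No
    enumeration of the index type is involved, so the bound passes to integers, to tuples and along
    injections. *)
Definition sums_bounded (I : eqType) (f : I -> R) (Z : R) :=
  forall s : seq I, uniq s -> \sum_(i <- s) f i <= Z.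

Lemma ler_sum_sub (I : eqType) (f : I -> R) (s t : seq I) :
  (forall i, 0 <= f i) -> uniq s -> {subset s <= t} ->
  \sum_(i <- s) f i <= \sum_(i <- t) f i.
Proof.
move=> f0; elim: s t => [|x s IHs] t /=.
  by move=> _ _; rewrite big_nil sumr_ge0.
move=> /andP[xs us] st; rewrite big_cons [leRHS](big_rem x) /=; last first.
  exact: (st x (mem_head _ _)).
rewrite lerD2l IHs // => y ys.
have yx : y != x by apply: contraNneq xs => <-.
have : y \in t by apply: st; rewrite in_cons ys orbT.
by rewrite (perm_mem (perm_to_rem (st x (mem_head _ _)))) in_cons (negbTE yx).
Qed.

Lemma sums_bounded_nat (f : nat -> R) Z : (forall i, 0 <= f i) ->
  (forall K, \sum_(i < K) f i <= Z) -> sums_bounded f Z.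
Proof.
move=> f0 fZ s us; apply: le_trans (fZ (\max_(i <- s) i).+1).
rewrite -(big_mkord xpredT) /index_iota subn0.
apply: ler_sum_sub => // i si.
by rewrite mem_iota add0n leq0n ltnS /= leq_bigmax_seq.
Qed.

(** Injectivity is asked only on [P]: integer vectors with small linear coefficients are determined
    by their leading entry, and this turns a sum over them into a sum over one integer. *)
Lemma sums_bounded_inj (I J : eqType) (h : I -> J) (f : J -> R) Z (P : pred I) :
  {in P &, injective h} -> sums_bounded f Z ->
  sums_bounded (fun i => if P i then f (h i) else 0) Z.
Proof.
move=> hi fZ s us; rewrite -big_mkcond /= -big_filter -(big_map h xpredT).
apply: fZ; rewrite map_inj_in_uniq ?filter_uniq // => x y.
by rewrite !mem_filter => /andP[Px _] /andP[Py _]; exact: hi.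
Qed.

Lemma sums_boundedZ (I : eqType) (f : I -> R) Z c : 0 <= c ->
  sums_bounded f Z -> sums_bounded (fun i => c * f i) (c * Z).
Proof. by move=> c0 fZ s us; rewrite -mulr_sumr ler_wpM2l// fZ. Qed.

Lemma sums_boundedD (I : eqType) (f g : I -> R) Y Z :
  sums_bounded f Y -> sums_bounded g Z ->
  sums_bounded (fun i => f i + g i) (Y + Z).
Proof. by move=> fY gZ s us; rewrite big_split lerD// ?fY ?gZ. Qed.

Lemma sums_bounded_le (I : eqType) (f g : I -> R) Z :
  (forall i, f i <= g i) -> sums_bounded g Z -> sums_bounded f Z.
Proof. by move=> fg gZ s us; apply: le_trans (gZ s us); exact: ler_sum. Qed.

Lemma sums_bounded_int (f : nat -> R) Z : sums_bounded f Z ->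
  sums_bounded (fun k : int => f `|k|%N) (Z + Z).
Proof.
move=> fZ.
pose P (k : int) := 0 <= k; pose Q (k : int) := k < 0.
apply: (@sums_bounded_le _ _ (fun k => (if P k then f `|k|%N else 0)
    + (if Q k then f `|k|%N else 0))).
  by move=> k; rewrite /P /Q; case: (leP 0 k); rewrite ?addr0 ?add0r.
apply: sums_boundedD.
  apply: (@sums_bounded_inj _ _ absz f Z P) => // x y.
  by rewrite /P !unfold_in /= => x0 y0; lia.
apply: (@sums_bounded_inj _ _ absz f Z Q) => // x y.
by rewrite /Q !unfold_in /= => x0 y0; lia.
Qed.

(** A finite family of tuples lies in the product of its set of heads and its set of tails. As all
    terms are nonnegative, enlarging the family to that product only increases the sum, which then
    factors. *)
Lemma sums_bounded_tuple (I : eqType) (f : I -> R) Z n :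
  (forall i, 0 <= f i) -> sums_bounded f Z ->
  sums_bounded (fun q : n.-tuple I => \prod_(i < n) f (tnth q i)) (Z ^+ n).
Proof.
move=> f0 fZ; elim: n => [|n IHn] s us.
  apply: le_trans (_ : \sum_(i <- [:: [tuple] : 0.-tuple I]) (1 : R) <= _).
    under eq_bigr do rewrite big_ord0.
    by apply: ler_sum_sub => // i _; rewrite tuple0 mem_head.
  by rewrite big_seq1.
have Z0 : 0 <= Z by have := fZ [::] isT; rewrite big_nil.
pose G (t : n.-tuple I) := \prod_(i < n) f (tnth t i).
pose H := undup (map (@thead n I) s).
pose T := undup (map (fun q : n.+1.-tuple I => [tuple of behead q]) s).
have -> : \sum_(i <- s) \prod_(i0 < n.+1) f (tnth i i0) =
    \sum_(u <- [seq (thead q, [tuple of behead q]) | q <- s]) f u.1 * G u.2.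
  rewrite big_map; apply: eq_bigr => q _; rewrite big_ord_recl /=; congr (_ * _).
  by apply: eq_bigr => i _; rewrite [in LHS](tuple_eta q) tnthS.
apply: (@le_trans _ _ (\sum_(u <- [seq (h, t) | h <- H, t <- T]) f u.1 * G u.2)).
  apply: ler_sum_sub.
  - by move=> u; rewrite mulr_ge0// prodr_ge0.
  - rewrite map_inj_uniq// => q r [h b].
    by rewrite (tuple_eta q) (tuple_eta r); apply: val_inj; rewrite /= h b.
  - move=> u /mapP[q qs ->]; apply/allpairsP.
    exists (thead q, [tuple of behead q]); split => //=.
      by rewrite mem_undup map_f.
    by rewrite mem_undup; apply/mapP; exists q.
rewrite big_allpairs /=.
under eq_bigr do rewrite -mulr_sumr.
rewrite -mulr_suml exprS ler_pM ?sumr_ge0//.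
- by move=> t _; rewrite prodr_ge0.
- by rewrite fZ// undup_uniq.
- by rewrite IHn// undup_uniq.
Qed.

(** Discrete form of comparison with an integral. The ratio of the two powers on the right is
    [expR (d * ln (k.+1%:R / k%:R))], the logarithm is at least [k.+1%:R^-1], and [expR x] is at
    least [1 + x]. *)
Lemma powRN_telescope (k : nat) (d : R) : 0 < d -> (0 < k)%N ->
  d * k.+1%:R `^ (- (1 + d)) <= k%:R `^ (- d) - k.+1%:R `^ (- d).
Proof.
move=> d0 k0.
have kR : 0 < k%:R :> R by rewrite ltr0n.
have k1 : 0 < k.+1%:R :> R by [].
rewrite opprD powRD; last by rewrite (gt_eqF k1) implybT.
rewrite powR_inv1 ?(ltW k1)//.
have -> : k%:R `^ (- d) = k.+1%:R `^ (- d) * expR (d * ln (k.+1%:R / k%:R)) :> R.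
  rewrite /powR !gt_eqF// -expRD; congr expR.
  by rewrite ln_div ?posrE//; ring.
set A := k.+1%:R `^ (- d); set E := expR _.
rewrite (_ : A * E - A = A * (E - 1)); last by ring.
rewrite (_ : d * (k.+1%:R^-1 * A) = A * (d * k.+1%:R^-1)); last by ring.
rewrite ler_pM2l ?powR_gt0// /E.
have := @expR_ge1Dx R (d * ln (k.+1%:R / k%:R)).
suff h1 : (k.+1%:R)^-1 <= ln (k.+1%:R / k%:R) :> R.
  move=> h2; rewrite lerBrDl; apply: le_trans h2.
  by rewrite lerD2l ler_pM2l.
rewrite -[k.+1%:R / _]invrK lnV; last by rewrite posrE invr_gt0 divr_gt0.
rewrite lerNr.
have -> : (k.+1%:R / k%:R)^-1 = 1 + - (k.+1%:R)^-1 :> R.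
  by rewrite -natr1; field; rewrite natr1 !gt_eqF.
by apply: le_ln1Dx; rewrite ltrN2 invf_lt1 // ltr1n ltnS.
Qed.

Lemma sums_bounded_powR (w : R) : 1 < w ->
  {Z : R | sums_bounded (fun k : int => Num.max 1 `|k%:~R| `^ (- w)) Z}.
Proof.
move=> w1; pose f (k : nat) : R := Num.max 1 k%:R `^ (- w).
have f0 k : 0 <= f k by exact: powR_ge0.
have d0 : 0 < w - 1 by lra.
pose Z := 2 + (w - 1)^-1.
exists (Z + Z).
apply: (@sums_bounded_le _ _ (fun k : int => f `|k|%N)).
  by move=> k; rewrite /f natr_absz intr_norm.
apply/sums_bounded_int/sums_bounded_nat => // K.
(* The terms of index 0 and 1 both equal 1 and make up the constant 2; the terms from index 2 on
   telescope. *)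
have fS K' : \sum_(i < K'.+2) f i <= 2 + (w - 1)^-1 * (1 - K'.+1%:R `^ (- (w - 1))).
  elim: K' => [|K' IH].
    rewrite !big_ord_recl big_ord0 /f /= /bump /= !powR1.
    by rewrite max_l// max_l// !powR1; lra.
  rewrite big_ord_recr /=; apply: le_trans (lerD IH (lexx _)) _.
  rewrite -addrA lerD2l.
  have := @powRN_telescope K'.+1 (w - 1) d0 isT.
  rewrite (_ : 1 + (w - 1) = w); last by ring.
  rewrite -(ler_pM2l (x := (w - 1)^-1)) ?invr_gt0// mulrA mulVf ?gt_eqF// mul1r.
  rewrite /f max_r ?ler1n//; lra.
case: K => [|[|K]].
- by rewrite big_ord0 /Z addr_ge0// invr_ge0 ltW.
- rewrite big_ord_recl big_ord0 /f /= max_l// powR1 /Z.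
  have : 0 <= (w - 1)^-1 by rewrite invr_ge0 ltW.
  by lra.
- apply: le_trans (fS K) _; rewrite lerD2l ler_piMr ?invr_ge0 ?ltW//.

Qed.

Lemma sums_bounded_geometric (r : R) : 0 <= r < 1 ->
  sums_bounded (fun k => r ^+ k) (1 - r)^-1.
Proof.
move=> /andP[r0 r1]; apply: sums_bounded_nat => [i|K]; first exact: exprn_ge0.
rewrite -[leRHS]mul1r ler_pdivlMr ?subr_gt0//.
have -> : (\sum_(i < K) r ^+ i) * (1 - r) = 1 - r ^+ K.
  elim: K => [|K IH]; first by rewrite big_ord0 mul0r expr0 subrr.
  by rewrite big_ord_recr mulrDl IH exprS /=; ring.
by rewrite gerBl exprn_ge0.
Qed.

(** The threshold is the [b]-th root of a number [D] that exceeds [C / c]. The summand 1 in [D]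
    makes this strict and gives [1 <= L]. *)
Lemma powRN_small (b C c : R) : 0 < b -> 0 < c ->
  exists2 L : R, 1 <= L & forall l, L <= l -> C * l `^ (- b) < c.
Proof.
move=> b0 c0; pose D := `|C| / c + 1.
have D1 : 1 <= D by rewrite lerDr divr_ge0 ?normr_ge0 ?ltW.
exists (D `^ b^-1).
  by rewrite -(powRr0 D) ler_powR// invr_ge0 ltW.
move=> l Dl.
have D0 : 0 < D by lra.
have l0 : 0 < l by apply: lt_le_trans Dl; exact: powR_gt0.
have : D <= l `^ b.
  rewrite -[D](@powRr1 _ D) ?(ltW D0)// -(@mulVf _ b) ?gt_eqF// powRrM.
  by apply: (ge0_ler_powR (ltW b0)); rewrite ?nnegrE ?powR_ge0 ?(ltW b0) ?(ltW l0).
move=> Dlb; rewrite powRN ltr_pdivrMr ?powR_gt0//.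
apply: le_lt_trans (ler_norm C) _.
rewrite mulrC -ltr_pdivrMr//; apply: lt_le_trans Dlb; rewrite /D; lra.
Qed.

End uniform_sums.

(** * Borel-Cantelli over a countable type *)

Section borel_cantelli_countable.
Context (I : countType) d (T : measurableType d) (R : realType).

(** The family is indexed by the codes of its indices, with the empty set at numbers that code
    nothing, so that it becomes a sequence with the same limsup set. *)
Definition pickle_set (A : I -> set T) (k : nat) : set T :=
  oapp A set0 (pickle_inv k).

Lemma infinite_lim_sup_set (A : I -> set T) :
  [set x | infinite_set [set i | A i x]] = lim_sup_set (pickle_set A).
Proof.
apply/seteqP; split => x /=.
  move=> inf n _; apply: contrapT => noA; apply: inf.
  apply: (@sub_finite_set _ _ [set` (pmap pickle_inv (iota 0 n) : seq I)]); last first.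
    exact: finite_seq.
  move=> i /= Aix; rewrite mem_pmap; apply/mapP; exists (pickle i); last first.
    by rewrite pickleK_inv.
  rewrite mem_iota /= add0n ltnNge; apply/negP => ni; apply: noA.
  by exists (pickle i) => //=; rewrite /pickle_set pickleK_inv.
move=> sup /finite_seqP[s sE].
have [k /=] := sup (\max_(i <- s) pickle i).+1 Logic.I.
rewrite /pickle_set; case E : (pickle_inv k) => [i|] /= ki; last by [].
move=> Aix.
have si : i \in s by have : [set` s] i by rewrite -sE.
have pk : pickle i = k by have := @pickle_invK I k; rewrite /ocancel E.
move: ki; rewrite -pk ltnNge leq_bigmax_seq; exact.
Qed.

Lemma measurable_pickle_set (A : I -> set T) :
  (forall i, measurable (A i)) -> forall k, measurable (pickle_set A k).
Proof.
move=> mA k; rewrite /pickle_set; case: (pickle_inv k) => [i|] /=.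
  exact: mA.
exact: measurable0.
Qed.

Lemma measurable_infinite_set (A : I -> set T) :
  (forall i, measurable (A i)) ->
  measurable [set x | infinite_set [set i | A i x]].
Proof.
move=> mA; rewrite infinite_lim_sup_set; apply: bigcap_measurable => // k _.
by apply: bigcup_measurable => j _; exact: measurable_pickle_set.
Qed.

Lemma borel_cantelli_countable (mu : {measure set T -> \bar R})
    (A : I -> set T) (f : I -> R) (Z : R) :
  (forall i, measurable (A i)) -> (forall i, (mu (A i) <= (f i)%:E)%E) ->
  sums_bounded f Z ->
  mu.-negligible [set x | infinite_set [set i | A i x]].
Proof.
move=> mA muA fZ; apply/negligibleP; first exact: measurable_infinite_set.
rewrite infinite_lim_sup_set; apply: lim_sup_set_cvg0.
  exact: measurable_pickle_set.
apply: (@le_lt_trans _ _ Z%:E); last exact: ltry.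
apply: lime_le; first by apply: is_cvg_nneseries => *; exact: measure_ge0.
apply: nearW => n.
rewrite /index_iota subn0.
(* Numbers that code no index contribute 0, and distinct codes decode to distinct indices, so each
   partial sum is one of the subsums bounded by [Z]. *)
have -> : (\sum_(i <- iota 0 n) mu (pickle_set A i) =
           \sum_(i <- pmap pickle_inv (iota 0 n)) mu (A i))%E.
  elim: (iota 0 n) => [|k s IHs]; first by rewrite !big_nil.
  rewrite big_cons IHs /= /pickle_set; case: (pickle_inv k) => [i|] /=.
    by rewrite big_cons.
  by rewrite measure0 add0e.
apply: (@le_trans _ _ (\sum_(i <- pmap pickle_inv (iota 0 n)) (f i)%:E)%E).
  by apply: lee_sum => i _.
rewrite sumEFin lee_fin fZ//.
by apply: (@pmap_uniq _ _ _ pickle) (iota_uniq _ _); exact: pickle_invK.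
Qed.

End borel_cantelli_countable.

(** * Measure of strips *)

Section slabs.
Context (R : realType).
Local Notation leb := (@lebesgue_measure R).

Definition box (m : nat) (M : R) : set (Rn R m) :=
  [set x | forall i, `|tnth x i| <= M].

Definition affine_form (m : nat) (c : 'I_m -> R) (d : R) (x : Rn R m) : R :=
  \sum_(i < m) c i * tnth x i + d.

Lemma measurable_affine_form m (c : 'I_m -> R) d :
  measurable_fun setT (affine_form c d : Rn R m -> measurableTypeR R).
Proof.
apply: (@measurable_funD _ (Rn R m) R) => //.
apply: (@measurable_sum _ (Rn R m) R) => i.
apply: (@measurable_funM _ (Rn R m) R) => //.
exact: measurable_tnth.
Qed.

Lemma norm_le_itv (M : R) : [set t : R | `|t| <= M] = [set` `[- M, M]].
Proof. by apply/seteqP; split => t /=; rewrite in_itv /= ler_norml. Qed.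

Lemma measurable_norm_le (M : R) :
  measurable ([set t | `|t| <= M] : set (measurableTypeR R)).
Proof. by rewrite norm_le_itv; exact: measurable_itv. Qed.

Lemma measurable_box m (M : R) : measurable (@box m M).
Proof.
rewrite (_ : box M = \bigcap_(i in [set: 'I_m])
    (fun t : Rn R m => tnth t i) @^-1` [set t | `|t| <= M]); last first.
  by apply/seteqP; split => t At i => [_|]; exact: At.
apply: fin_bigcap_measurable => // i _.
rewrite -[X in measurable X]setTI; apply: measurable_tnth => //.
exact: measurable_norm_le.
Qed.

Lemma lebesgue_norm_le (M : R) : 0 <= M ->
  leb [set t | `|t| <= M] = (2 * M)%:E.
Proof.
move=> M0; rewrite norm_le_itv lebesgue_measure_itv /= lte_fin.
case: ltP => MM; first by rewrite -EFinD; congr EFin; lra.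
by congr EFin; lra.
Qed.

Lemma lebesgue_box m (M : R) : 0 <= M ->
  lebesgue_Rn R m (box M) = ((2 * M) ^+ m)%:E.
Proof.
move=> M0; rewrite (@lebesgue_Rn_box R m (fun=> [set t | `|t| <= M])).
  rewrite (eq_bigr (fun=> (2 * M)%:E)); last by move=> i _; exact: lebesgue_norm_le.
  by rewrite prodEFin prodr_const card_ord.
by move=> _; exact: measurable_norm_le.
Qed.

(** Tonelli, slicing at a fixed first coordinate. The companion lemma for [ysection] fixes the
    remaining coordinates instead; the induction on the dimension of a slab needs both. *)
Lemma lebesgue_prod_le_xsection m (M B : R) (S : set (measurableTypeR R * Rn R m)) :
  0 <= M -> 0 <= B -> measurable S ->
  (forall t x, S (t, x) -> `|t| <= M) ->
  (forall t, (lebesgue_Rn R m [set x | S (t, x)] <= B%:E)%E) ->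
  ((leb \x lebesgue_Rn R m) S <= (2 * M * B)%:E)%E.
Proof.
move=> M0 B0 mS SM SB; rewrite /product_measure1.
apply: (@le_trans _ _ (\int[leb]_t (B%:E * (\1_[set t | `|t| <= M] t)%:E))%E).
  apply: ge0_le_integral => //.
  - exact: measurable_fun_xsection.
  - apply: measurable_funeM; apply: measurableT_comp => //.
    apply: measurable_indic; exact: measurable_norm_le.
  - move=> t _ /=; rewrite (_ : xsection S t = [set x | S (t, x)]); last first.
      by apply/seteqP; split => x; rewrite /xsection /= inE.
    rewrite indicE; have [tM|tM] := pselect (`|t| <= M).
      by rewrite mem_set// mule1.
    rewrite memNset//= mule0 (_ : [set x | _] = set0) ?measure0//.
    by apply/seteqP; split => // x /= /SM.
rewrite ge0_integralZl//; last first.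
  apply: measurableT_comp => //; apply: measurable_indic; exact: measurable_norm_le.
rewrite integral_indic ?setIT//; last exact: measurable_norm_le.
by rewrite [X in (_ * X <= _)%E](lebesgue_norm_le M0) -EFinM lee_fin mulrC.
Qed.

Lemma lebesgue_prod_le_ysection m (M B : R) (S : set (measurableTypeR R * Rn R m)) :
  0 <= M -> 0 <= B -> measurable S ->
  (forall t x, S (t, x) -> box M x) ->
  (forall x, (leb [set t | S (t, x)] <= B%:E)%E) ->
  ((leb \x lebesgue_Rn R m) S <= ((2 * M) ^+ m * B)%:E)%E.
Proof.
move=> M0 B0 mS SM SB.
(* The product measure is replaced by the one integrated in the other order; the two agree on
   rectangles. *)
rewrite (@product_measure_unique _ _ _ _ R leb (lebesgue_Rn R m)
   (leb \x^ lebesgue_Rn R m)%E)//; last by move=> *; exact: product_measure2E.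
rewrite /product_measure2.
apply: (@le_trans _ _ (\int[lebesgue_Rn R m]_x (B%:E * (\1_(box M) x)%:E))%E).
  apply: ge0_le_integral => //.
  - exact: measurable_fun_ysection.
  - apply: measurable_funeM; apply: measurableT_comp => //.
    apply: measurable_indic; exact: measurable_box.
  - move=> x _ /=; rewrite (_ : ysection S x = [set t | S (t, x)]); last first.
      by apply/seteqP; split => t; rewrite /ysection /= inE.
    rewrite indicE; have [tM|tM] := pselect (box M x).
      by rewrite mem_set// mule1.
    rewrite memNset//= mule0 (_ : [set t | _] = set0) ?measure0//.
    by apply/seteqP; split => // t /= /SM.
rewrite ge0_integralZl//; last first.
  apply: measurableT_comp => //; apply: measurable_indic; exact: measurable_box.
rewrite integral_indic ?setIT//; last exact: measurable_box.
by rewrite [X in (_ * X <= _)%E](lebesgue_box m M0) -EFinM lee_fin mulrC.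
Qed.

Lemma measurable_slab m (c : 'I_m -> R) (d M : R) (P : set (measurableTypeR R)) :
  measurable P -> measurable (box M `&` affine_form c d @^-1` P).
Proof.
move=> mP; apply: measurableI; first exact: measurable_box.
by rewrite -[X in measurable X]setTI; exact: measurable_affine_form.
Qed.

(** Fubini along the direction [j], where each line meets the slab in measure at most [B].
    Coordinates before [j] are peeled off by induction, each costing a factor [2 * M]. *)
Lemma slab_measure_le m (c : 'I_m -> R) (j : 'I_m) (d M B : R)
    (P : set (measurableTypeR R)) :
  1 <= M -> 0 <= B -> measurable P ->
  (forall e, (leb [set t | `|t| <= M /\ P (c j * t + e)]%R <= B%:E)%E) ->
  (lebesgue_Rn R m (box M `&` affine_form c d @^-1` P) <=
    ((2 * M) ^+ m * B)%:E)%E.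
Proof.
move=> M1 B0 mP PB; have M0 : 0 <= M by lra.
elim: m c j d PB => [c []//|m IHm] c j d PB.
pose S := @cons_pair R m @^-1` (box M `&` affine_form c d @^-1` P).
have mS : measurable S.
  rewrite -[X in measurable X]setTI; apply: measurable_cons_pair => //.
  exact: measurable_slab.
have SE t x : S (t, x) <-> (`|t| <= M /\ box M x) /\
    P (c ord0 * t + affine_form (c \o lift ord0) d x).
  have fE : affine_form c d (cons_pair (t, x)) =
      c ord0 * t + affine_form (c \o lift ord0) d x.
    rewrite /affine_form big_ord_recl addrA; congr (_ + _ + _).
    by apply: eq_bigr => i _; rewrite tnthS.
  rewrite /S /= fE; split => -[Bx Px]; split => //.
    split; first exact: (Bx ord0).
    by move=> i; have := Bx (lift ord0 i); rewrite tnthS.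
  move=> i; case: (unliftP ord0 i) => [k ->|->]; last exact: Bx.1.
  by rewrite tnthS; exact: Bx.2.
change ((leb \x lebesgue_Rn R m) S <= ((2 * M) ^+ m.+1 * B)%:E)%E.
have B0' : 0 <= (2 * M) ^+ m * B by rewrite mulr_ge0// exprn_ge0//; lra.
have [jk|j0] := unliftP ord0 j.
  move=> jE; rewrite exprS -mulrA; apply: lebesgue_prod_le_xsection => //.
    by move=> t x /SE[[]].
  move=> t; have := IHm (c \o lift ord0) jk (c ord0 * t + d).
  rewrite /= -jE => /(_ PB); apply: le_trans; apply: le_measure.
  - rewrite inE; rewrite (_ : [set x | _] = xsection S t).
      exact: measurable_xsection.
    by apply/seteqP; split => x; rewrite /xsection /= inE.
  - by rewrite inE; exact: measurable_slab.
  - move=> x /SE[[_ Bx] Px]; split => //=; move: Px.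
    by rewrite /affine_form addrCA.
move: PB; rewrite j0 => PB.
(* The line in direction [j] costs no factor [2 * M]; one is added to get a uniform exponent, which
   is where [1 <= M] serves. *)
apply: (@le_trans _ _ ((2 * M) ^+ m * B)%:E).
  apply: lebesgue_prod_le_ysection => //; first by move=> t x /SE[[]].
  move=> x; apply: le_trans (PB (affine_form (c \o lift ord0) d x)).
  apply: le_measure.
  - rewrite inE; rewrite (_ : [set t | _] = ysection S x).
      exact: measurable_ysection.
    by apply/seteqP; split => t; rewrite /ysection /= inE.
  - rewrite inE; rewrite (_ : [set t | _] = [set t | `|t| <= M] `&`
       (fun t => c ord0 * t + affine_form (c \o lift ord0) d x) @^-1` P)//.
    apply: measurableI; first exact: measurable_norm_le.
    rewrite -[X in measurable X]setTI.
    suff : measurable_fun setT (fun t => c ord0 * t +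
       affine_form (c \o lift ord0) d x : measurableTypeR R) by exact.
    by apply: measurable_funD => //; exact: measurable_funM.
  - by move=> t /SE[[]].
by rewrite lee_fin exprS -mulrA ler_peMl//; lra.
Qed.

Lemma measurable_norm_lt (eps : R) :
  measurable ([set u | `|u| < eps] : set (measurableTypeR R)).
Proof.
rewrite (_ : mkset _ = [set` `](- eps), eps[]); first exact: measurable_itv.
by apply/seteqP; split => t /=; rewrite in_itv /= ltr_norml.
Qed.

Lemma strip_line_le (c e eps : R) (M : R) : c != 0 -> 0 <= eps ->
  (leb [set t | `|t| <= M /\ `|c * t + e| < eps]%R <= (2 * eps / `|c|)%:E)%E.
Proof.
move=> c0 eps0; have c0' : 0 < `|c| by rewrite normr_gt0.
pose I : set (measurableTypeR R) := [set` `](- e / c - eps / `|c|), (- e / c + eps / `|c|)[].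
apply: (@le_trans _ _ (leb I)).
  apply: le_measure; rewrite ?inE.
  - rewrite (_ : mkset _ = [set t | `|t| <= M] `&`
       (fun t => c * t + e) @^-1` [set u | `|u| < eps])//.
    apply: measurableI; first exact: measurable_norm_le.
    rewrite -[X in measurable X]setTI.
    suff : measurable_fun setT (fun t => c * t + e : measurableTypeR R).
      by apply => //; exact: measurable_norm_lt.
    by apply: measurable_funD => //; exact: measurable_funM.
  - exact: measurable_itv.
  - move=> t /= [_ te]; rewrite /I /= in_itv /= -ltr_distl.
    have -> : t - - e / c = (c * t + e) / c by field.
    by rewrite normrM normfV ltr_pM2r ?invr_gt0.
rewrite /I lebesgue_measure_itv /= lte_fin; case: ifP => _.
  by rewrite -EFinD lee_fin; lra.
by rewrite lee_fin divr_ge0// mulr_ge0.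
Qed.

Definition near_int (eps : R) : set (measurableTypeR R) :=
  [set u | exists p : int, `|u + p%:~R| < eps].

Lemma measurable_near_int eps : measurable (near_int eps).
Proof.
rewrite (_ : near_int eps = \bigcup_(p in [set: int])
   (fun u => u + p%:~R) @^-1` [set u | `|u| < eps]); last first.
  by apply/seteqP; split => [u [p pu]|u [p _ pu]]; exists p.
apply: countable_bigcupT_measurable => [|p]; first exact: countableP.
 rewrite -[X in measurable X]setTI.
suff : measurable_fun setT (fun t : R => t + p%:~R : measurableTypeR R).
  by apply => //; exact: measurable_norm_lt.
exact: measurable_funD.
Qed.

(** The set is a union of intervals of length at most [2 * eps / |c|], one for each integer that can
    occur. There are at most [2 * M * |c| + 4] of these, and [1 <= M] absorbs the constants into
    10. *)
Lemma near_int_line_le (c e eps M : R) : c != 0 -> 0 <= eps <= 1 -> 1 <= M ->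
  (leb [set t | `|t| <= M /\ near_int eps (c * t + e)]%R <=
    (10 * M * eps * (1 + `|c|^-1))%:E)%E.
Proof.
move=> c0 /andP[eps0 eps1] M1; have c0' : 0 < `|c| by rewrite normr_gt0.
(* Since [|c * t| <= M * |c|] and [eps <= 1], an integer that occurs is within [M * |c| + 1] of
   [- e]. The lower end is rounded down to [p0], which turns the length [2 * M * |c| + 2] into
   [2 * M * |c| + 3]. *)
pose p0 : int := Num.floor (- e - 1 - M * `|c|).
pose K : nat := (Num.truncn (2 * M * `|c| + 3)).+1.
pose F (k : nat) : set (measurableTypeR R) :=
  [set t | `|t| <= M /\ `|c * t + (e + (p0 + k%:Z)%:~R)| < eps].
have mF k : measurable (F k).
  rewrite (_ : F k = [set t | `|t| <= M] `&`
       (fun t => c * t + (e + (p0 + k%:Z)%:~R)) @^-1` [set u | `|u| < eps])//.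
  apply: measurableI; first exact: measurable_norm_le.
  rewrite -[X in measurable X]setTI.
  suff : measurable_fun setT (fun t => c * t + (e + (p0 + k%:Z)%:~R) : measurableTypeR R).
    by apply => //; exact: measurable_norm_lt.
  by apply: measurable_funD => //; exact: measurable_funM.
apply: (@le_trans _ _ (leb (\big[setU/set0]_(k < K) F k))).
  apply: le_measure; rewrite ?inE.
  - rewrite (_ : mkset _ = [set t | `|t| <= M] `&`
       (fun t => c * t + e) @^-1` near_int eps)//.
    apply: measurableI; first exact: measurable_norm_le.
    rewrite -[X in measurable X]setTI.
    suff : measurable_fun setT (fun t => c * t + e : measurableTypeR R).
      by apply => //; exact: measurable_near_int.
    by apply: measurable_funD => //; exact: measurable_funM.
  - exact: bigsetU_measurable.
  - move=> t [tM [p pt]].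
    have ctM : `|c * t| <= M * `|c| by rewrite normrM mulrC ler_pM2r.
    move: pt ctM; rewrite ltr_norml ler_norml => /andP[h1 h2] /andP[h3 h4].
    have p0le := floor_le (- e - 1 - M * `|c|).
    have p0lt := floorD1_gt (- e - 1 - M * `|c|).
    rewrite -/p0 intrD in p0le p0lt.
    have p0p : p0 <= p.
      rewrite -ltzD1 -(ltr_int R) intrD; lra.
    pose k := `|p - p0|%N.
    have kE : p0 + k%:Z = p by rewrite /k gez0_abs ?subr_ge0// addrCA subrr addr0.
    have kK : (k < K)%N.
      rewrite /K ltnS truncn_ge_nat; last first.
        by have : 0 <= M * `|c| by [apply: mulr_ge0; lra]; lra.
      have -> : k%:R = p%:~R - p0%:~R :> R.
        by rewrite -intrB -kE [p0 + _]addrC addrK pmulrn.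
      lra.
    rewrite -bigcup_mkord; exists k => //=; split => //.
    by rewrite kE addrA ltr_norml h1 h2.
apply: le_trans (le_mu_bigsetU _ _) _ => //.
apply: (@le_trans _ _ (\sum_(k < K) (2 * eps / `|c|)%:E)%E).
  by apply: lee_sum => k _; exact: strip_line_le.
rewrite sumEFin lee_fin sumr_const card_ord -[_ *+ K]mulr_natr.
have KR : K%:R <= 2 * M * `|c| + 4.
  rewrite /K -natr1; have := truncn_le (2 * M * `|c| + 3).
  have -> : 0 <= 2 * M * `|c| + 3.
    by have : 0 <= M * `|c| by [apply: mulr_ge0; lra]; lra.
  lra.
have cV : 0 < `|c|^-1 by rewrite invr_gt0.
apply: (@le_trans _ _ (2 * eps / `|c| * (2 * M * `|c| + 4))).
  by rewrite ler_wpM2l// mulr_ge0 ?(ltW cV)// mulr_ge0.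
have -> : 2 * eps / `|c| * (2 * M * `|c| + 4) = 4 * M * eps + 8 * eps / `|c|.
  by field; rewrite gt_eqF.
have Me : eps <= M * eps by rewrite ler_peMl.
have : eps / `|c| <= M * eps / `|c| by rewrite ler_pM2r.
have : 0 <= M * eps / `|c| by rewrite mulr_ge0 ?(ltW cV)// mulr_ge0//; lra.
have : 0 <= M * eps by lra.
lra.
Qed.

Lemma near_int_slab_le m (c : 'I_m -> R) (j : 'I_m) (d M eps : R) :
  c j != 0 -> 0 <= eps <= 1 -> 1 <= M ->
  (lebesgue_Rn R m (box M `&` affine_form c d @^-1` near_int eps) <=
    ((2 * M) ^+ m * (10 * M * eps * (1 + `|c j|^-1)))%:E)%E.
Proof.
move=> cj eps01 M1; apply: (@slab_measure_le _ _ j) => //.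
- by case/andP: eps01 => *; rewrite mulr_ge0 ?addr_ge0 ?invr_ge0// mulr_ge0//; lra.
- exact: measurable_near_int.
- by move=> e; exact: near_int_line_le.
Qed.

Lemma strip_slab_le m (c : 'I_m -> R) (j : 'I_m) (d M eps : R) :
  c j != 0 -> 0 <= eps -> 1 <= M ->
  (lebesgue_Rn R m (box M `&` affine_form c d @^-1` [set u | `|u| < eps]%R) <=
    ((2 * M) ^+ m * (2 * eps / `|c j|))%:E)%E.
Proof.
move=> cj eps0 M1; apply: (@slab_measure_le _ _ j) => //.
- by rewrite divr_ge0// mulr_ge0.
- exact: measurable_norm_lt.
- by move=> e; exact: strip_line_le.
Qed.

End slabs.

(** * Norms, and Dirichlet's theorem for a linear form *)

Section norms.
Context (R : realType) (n : nat) (N : 'rV[R]_n.+1 -> R) (hN : is_norm N).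

Lemma is_norm_eq0 : N 0 = 0.
Proof. by have := is_normZ hN 0 0; rewrite scaler0 normr0 mul0r. Qed.

Lemma is_normN x : N (- x) = N x.
Proof. by rewrite -scaleN1r (is_normZ hN) normrN normr1 mul1r. Qed.

Lemma is_norm_ge0 x : 0 <= N x.
Proof.
by have := is_normD hN x (- x); rewrite subrr is_norm_eq0 is_normN; lra.
Qed.

Lemma is_norm_sum (I : Type) (s : seq I) (F : I -> 'rV[R]_n.+1) :
  N (\sum_(i <- s) F i) <= \sum_(i <- s) N (F i).
Proof.
elim: s => [|i s IHs]; first by rewrite !big_nil is_norm_eq0.
by rewrite !big_cons (le_trans (is_normD hN _ _))// lerD2l.
Qed.

Lemma is_norm_le_coord : exists2 C : R, 0 < C &
  forall (x : 'rV[R]_n.+1) B, (forall i, `|x ord0 i| <= B) -> N x <= C * B.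
Proof.
exists (\sum_i N (delta_mx ord0 i) + 1).
  by rewrite ltr_wpDl// sumr_ge0// => i _; exact: is_norm_ge0.
move=> x B xB; have B0 : 0 <= B by exact: le_trans (xB ord0).
rewrite {1}[x]row_sum_delta (le_trans (is_norm_sum _ _))// mulrDl mul1r.
rewrite ler_wpDr// mulr_suml ler_sum// => i _.
by rewrite (is_normZ hN) mulrC ler_wpM2l ?is_norm_ge0.
Qed.

Lemma is_norm_dist x y : `|N x - N y| <= N (x - y).
Proof.
have h z t : N z - N t <= N (z - t).
  by have := is_normD hN (z - t) t; rewrite subrK; lra.
rewrite ler_norml h andbT.
by have := h y x; rewrite -[N (y - x)]is_normN opprB; lra.
Qed.

Lemma coord_le_mx_norm (x : 'rV[R]_n.+1) i : `|x ord0 i| <= `|x|.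
Proof.
have /mapP[j Hj ->] : `|x ord0 i| \in [seq `|x k.1 k.2| | k : 'I_1 * 'I_n.+1].
  by apply/mapP; exists (ord0, i) => //=; rewrite mem_enum.
by rewrite [leRHS]/Num.norm /= mx_normrE; apply/bigmax_geP; right => /=; exists j.
Qed.

Lemma is_norm_continuous : continuous N.
Proof.
have [C C0 NC] := is_norm_le_coord.
move=> x A /nbhs_ballP[e /= e0 eA]; apply/nbhs_ballP.
exists (e / C) => /=; first exact: divr_gt0.
move=> y; rewrite -ball_normE /= => xy; apply: eA; rewrite -ball_normE /=.
apply: le_lt_trans (is_norm_dist _ _) _.
apply: le_lt_trans (NC _ `|x - y| _) _; first exact: coord_le_mx_norm.
by rewrite -ltr_pdivlMl// mulrC.
Qed.

(** The unit sphere of the sup norm is compact and [N] is continuous, so [N] attains a minimum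
    there. It is positive by definiteness, and its inverse is the constant. *)
Lemma coord_le_is_norm : exists2 C : R, 0 < C &
  forall (x : 'rV[R]_n.+1) i, `|x ord0 i| <= C * N x.
Proof.
pose S : set 'rV[R]_n.+1 := [set x | `|x| = 1].
have S0 : S !=set0.
  pose d : 'rV[R]_n.+1 := delta_mx ord0 ord0.
  exists (`|d|^-1 *: d) => /=.
  rewrite /S /= normrZ normfV normr_id mulVf// normr_eq0; apply/eqP.
  by move/matrixP/(_ ord0 ord0); rewrite !mxE !eqxx => /eqP; rewrite oner_eq0.
have cS : compact S.
  apply: bounded_closed_compact.
    by exists 1; split => // M M1 x; rewrite /S /= => ->; exact: ltW.
  rewrite (_ : S = (fun x => `|x|) @^-1` [set 1])//.
  apply: preimage_closed; last exact: closed_eq.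
  by move=> x _; exact: norm_continuous.
have [|c cS' cmin] := EVT_min_rV S0 cS (f := N).
  by apply: continuous_subspaceT; exact: is_norm_continuous.
move: cS'; rewrite inE /S /= => c1.
have Nc : 0 < N c.
  rewrite lt_neqAle is_norm_ge0 andbT; apply/eqP => /esym/(is_norm0_eq0 hN) c0.
  by move: c1; rewrite c0 normr0 => /eqP; rewrite eq_sym oner_eq0.
exists (N c)^-1; first by rewrite invr_gt0.
move=> x i; rewrite mulrC ler_pdivlMr//.
have [->|x0] := eqVneq x 0; first by rewrite mxE normr0 mul0r is_norm_ge0.
have x0' : 0 < `|x| by rewrite normr_gt0.
apply: (@le_trans _ _ (`|x| * N c)).
  by rewrite ler_pM2r// coord_le_mx_norm.
have : N c <= N (`|x|^-1 *: x).
  by apply: cmin; rewrite inE /S /= normrZ normfV normr_id mulVf ?gt_eqF.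
by rewrite (is_normZ hN) normfV normr_id -ler_pdivrMl ?invr_gt0// invrK.
Qed.

End norms.

(** * Dirichlet's theorem and the bound by [n] at every point *)

Section lower.
Context (R : realType).

Lemma Pi_plus_ge1 n (y : n.-tuple R) : 1 <= Pi_plus y.
Proof.
rewrite /Pi_plus; elim/big_ind: _ => // [x z x1 z1|i _].
  by rewrite -[1]mulr1 ler_pM.
by rewrite le_max lexx.
Qed.

Lemma dirichlet_form n (y : n.+1.-tuple R) (Q : nat) : (0 < Q)%N ->
  exists q : n.+1.-tuple int, [/\ exists i, tnth q i != 0,
    forall i, `|(tnth q i)%:~R : R| <= Q%:R &
    (* There are [T'.+2] vectors with entries from 0 to [Q], and the fractional parts of their
       values fall into [T'.+1] intervals of equal length. Two vectors share an interval, and their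
       difference is the required [q]. *)
    exists p : int, `|dotR (int_vec R q) y + p%:~R| < (Q%:R ^+ n.+1)^-1].
Proof.
move=> Q0; pose T' := (Q.+1 ^ n.+1 - 2)%N.
have TE : (T'.+2 = Q.+1 ^ n.+1)%N.
  have : (2 ^ n.+1 <= Q.+1 ^ n.+1)%N by rewrite leq_exp2r.
  have : (2 <= 2 ^ n.+1)%N by rewrite expnS leq_pmulr// expn_gt0.
  rewrite /T'; lia.
pose X (g : {ffun 'I_n.+1 -> 'I_Q.+1}) : R := \sum_i (g i)%:R * tnth y i.
pose fr (x : R) := x - (Num.floor x)%:~R.
have fr01 x : 0 <= fr x < 1.
  have := floor_itv x; rewrite /fr intrD => /andP[]; lra.
pose F g : 'I_T'.+1 := inord (Num.truncn (T'.+1%:R * fr (X g))).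
have FE g : F g = Num.truncn (T'.+1%:R * fr (X g)) :> nat.
  rewrite inordK// truncn_lt_nat; last by rewrite mulr_ge0//; case/andP: (fr01 (X g)).
  by rewrite gtr_pMr//; case/andP: (fr01 (X g)).
have [g [h [gh Fgh]]] : exists g h, g <> h /\ F g = F h.
  apply: contrapT => noex.
  have Finj : injective F.
    by move=> g h Fgh; apply: contrapT => gh; apply: noex; exists g, h.
  by have := leq_card F Finj; rewrite card_ffun !card_ord -TE ltnn.
exists [tuple (Posz (g i) - Posz (h i)) | i < n.+1]; split.
- apply: contrapT => noi; apply: gh; apply/ffunP => i; apply/val_inj/eqP.
  rewrite -eqz_nat -subr_eq0; apply/negPn/negP => ghi; apply: noi.
  by exists i; rewrite tnth_mktuple.
- move=> i; rewrite tnth_mktuple intrB -!pmulrn ler_norml.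
  have := ltn_ord (g i); have := ltn_ord (h i); rewrite !ltnS -!(ler_nat R).
  have : 0 <= (g i)%:R :> R by []. have : 0 <= (h i)%:R :> R by [].
  lra.
exists (Num.floor (X h) - Num.floor (X g)).
have -> : dotR (int_vec R [tuple (Posz (g i) - Posz (h i)) | i < n.+1]) y +
    (Num.floor (X h) - Num.floor (X g))%:~R = fr (X g) - fr (X h).
  rewrite /fr intrB /dotR.
  have -> : \sum_(i < n.+1) tnth (int_vec R [tuple (Posz (g i) - Posz (h i)) | i < n.+1]) i
      * tnth y i = X g - X h.
    rewrite /X -sumrB; apply: eq_bigr => i _.
    by rewrite !tnth_mktuple intrB -!pmulrn mulrBl.
  by ring.
have T0 : 0 < T'.+1%:R :> R by [].
apply: (@lt_le_trans _ _ (T'.+1%:R)^-1).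
  rewrite -(ltr_pM2l T0) divff ?gt_eqF// -[X in X * `|_|]gtr0_norm// -normrM mulrBr.
  have := congr1 val Fgh; rewrite /= !FE => E.
  have := @truncn_itv R (T'.+1%:R * fr (X g)); have := @truncn_itv R (T'.+1%:R * fr (X h)).
  rewrite -E !mulr_ge0 //; [|by case/andP: (fr01 (X g))|by case/andP: (fr01 (X h))].
  move=> /(_ isT)/andP[a1 a2] /(_ isT)/andP[b1 b2].
  move: a2 b2; rewrite -![(Num.truncn _).+1%:R]natr1 ltr_norml => a2 b2; lra.
rewrite lef_pV2 ?posrE ?exprn_gt0 ?ltr0n// -natrX ler_nat -ltnS TE.
by rewrite ltn_exp2r.
Qed.

Lemma finite_int_tuple_bound n (S : set (n.-tuple int)) : finite_set S ->
  exists B : nat, forall q, S q -> forall i, (`|tnth q i| <= B)%N.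
Proof.
move=> /finite_seqP[s ->].
exists (\max_(q <- s) \max_(i < n) `|tnth q i|)%N => q /= qs i.
apply: leq_trans (leq_bigmax_seq _ qs isT).
exact: (leq_bigmax_cond (F := fun i => `|tnth q i|%N)).
Qed.

Lemma dist_int_gt0 (x : R) : (forall p : int, x + p%:~R != 0) ->
  exists2 e : R, 0 < e & forall p : int, e <= `|x + p%:~R|.
Proof.
move=> xp; have := floor_itv x; rewrite intrD => /andP[f1 f2].
have f3 : x - (Num.floor x)%:~R != 0 by rewrite -intrN; exact: xp.
(* The distances from [x] to the integers just below and just above it. *)
exists (Num.min (x - (Num.floor x)%:~R) (1 - (x - (Num.floor x)%:~R))).
  by rewrite lt_min; apply/andP; split; [rewrite lt_neqAle eq_sym f3 /=|]; lra.
move=> p; rewrite ge_min.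
have [pf|pf] := leP (- Num.floor x) p.
  apply/orP; left; apply: le_trans (ler_norm _).
  by rewrite lerD2l -intrN ler_int.
apply/orP; right; rewrite -normrN; apply: le_trans (ler_norm _).
have : (p + 1)%:~R <= (- Num.floor x)%:~R :> R by rewrite ler_int; lia.
by rewrite intrD intrN; lra.
Qed.

(** At the exponent [n] itself the set of solutions is infinite. If it were finite, the values of
    its nonzero members would stay at some distance from the integers, and Dirichlet's theorem would
    give a solution below that distance. *)
Lemma mult_exponent_ge n (y : n.+1.-tuple R) :
  ((n.+1%:R)%:E <= mult_exponent y)%E.
Proof.
apply: ereal_sup_ubound => /=; exists n.+1%:R => //=.
rewrite divff ?pnatr_eq0//.
set S := (X in infinite_set X) => finS.
have [B SB] := finite_int_tuple_bound finS.
(* A nonzero [q] with an exact integer value would put all its multiples in [S]; the multiple by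
   [B.+1] already has an entry above the bound [B]. *)
have noz (q : n.+1.-tuple int) (p : int) : (exists i, tnth q i != 0) ->
    dotR (int_vec R q) y + p%:~R != 0.
  move=> [i qi]; apply/eqP => qp0.
  pose q' : n.+1.-tuple int := [tuple (Posz B.+1 * tnth q j) | j < n.+1].
  have : S q'.
    exists (Posz B.+1 * p); apply: le_lt_trans (_ : 0 < _).
      rewrite (_ : dotR _ _ = B.+1%:R * dotR (int_vec R q) y).
        by rewrite intrM -pmulrn -mulrDr qp0 mulr0 normr0.
      rewrite /dotR mulr_sumr; apply: eq_bigr => j _.
      by rewrite !tnth_mktuple intrM -pmulrn mulrA.
    by rewrite powR_gt0// (lt_le_trans _ (Pi_plus_ge1 _)).
  move=> /SB/(_ i); rewrite tnth_mktuple abszM absz_nat.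
  have : (0 < `|tnth q i|)%N by rewrite absz_gt0.
  by case: `|tnth q i|%N => // k _; rewrite mulnS; lia.
have [e e0 Se] : exists2 e : R, 0 < e & forall q, S q ->
    (exists i, tnth q i != 0) -> forall p : int, e <= `|dotR (int_vec R q) y + p%:~R|.
  move/finite_seqP : finS => [s ->].
  elim: s => [|q s [e e0 IHs]]; first by exists 1.
  have [[i qi]|qi] := pselect (exists i, tnth q i != 0); last first.
    by exists e => // r /=; rewrite in_cons => /orP[/eqP -> //|]; exact: IHs.
  have [e' e'0 qe'] := @dist_int_gt0 (dotR (int_vec R q) y)
     (fun p => noz q p (ex_intro _ i qi)).
  exists (Num.min e e'); first by rewrite lt_min e0.
  move=> r /=; rewrite in_cons => /orP[/eqP ->|rs] ri p; rewrite ge_min.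
    by rewrite qe' orbT.
  by rewrite (IHs r).
(* With [Q] above the inverse of [e], the vector from Dirichlet's theorem belongs to [S], because
   its [Pi_plus] is at most [Q ^ n.+1], and its value is below [e]. *)
pose Q := (Num.truncn e^-1).+1.
have Q0 : (0 < Q)%N by [].
have Q1 : 1 <= Q%:R :> R by rewrite ler1n.
have [q [q0 qQ [p qp]]] := dirichlet_form y Q0.
have : S q.
  exists p; apply: lt_le_trans qp _; rewrite powR_inv1; last first.
    exact: le_trans (Pi_plus_ge1 _).
  rewrite lef_pV2 ?posrE ?exprn_gt0 ?ltr0n//; last first.
    exact: lt_le_trans (Pi_plus_ge1 _).
  rewrite /Pi_plus; apply: le_trans (_ : \prod_(i < n.+1) Q%:R <= _).
    apply: ler_prod => i _; rewrite le_max ler01 /= ge_max Q1 /=.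
    by rewrite tnth_mktuple qQ.
  by rewrite prodr_const card_ord.
move=> /Se/(_ q0 p); apply/negP; rewrite -ltNge.
apply: lt_le_trans qp _; rewrite -[leRHS]invrK.
rewrite lef_pV2 ?posrE ?exprn_gt0 ?ltr0n ?invr_gt0//.
apply: le_trans (_ : Q%:R <= _); first by apply/ltW/truncnS_gt.
by rewrite exprS ler_peMr ?exprn_ege1// ltW// ltr0n.
Qed.

End lower.

(** * Lower bound *)

Lemma finite_int_tuple n (B : nat) :
  finite_set [set q : n.-tuple int | forall i, (`|tnth q i| <= B)%N].
Proof.
pose h (f : {ffun 'I_n -> 'I_(B + B).+1}) : n.-tuple int :=
  [tuple (Posz (f i) - Posz B) | i < n].
apply: (@sub_finite_set _ _ (h @` setT)); last exact/finite_image/finite_finset.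
move=> q qB; exists [ffun i => inord `|tnth q i + Posz B|] => //.
apply: eq_from_tnth => i; rewrite tnth_mktuple ffunE.
have := qB i => qiB; rewrite inordK; lia.
Qed.

Lemma finite_int_norm_lt (R : realType) (L : R) :
  finite_set [set k : int | `|k%:~R : R| < L].
Proof.
pose B := Num.truncn L.
apply: (@sub_finite_set _ _
  ((fun q : 1.-tuple int => tnth q ord0) @` [set q | forall i, (`|tnth q i| <= B)%N])).
  move=> k /= kL; exists [tuple k] => //= i; rewrite ord1 (tnth_nth 0) /=.
  have L0 : 0 <= L by apply/ltW/(le_lt_trans _ kL).
  by rewrite /B truncn_ge_nat// natr_absz intr_norm ltW.
exact/finite_image/finite_int_tuple.
Qed.

Lemma int_norm_lt1 (R : realType) (k : int) : `|k%:~R : R| < 1 -> k = 0.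
Proof. by rewrite -intr_norm -[1]/(1%:~R) ltr_int; lia. Qed.

(** * The affine form of an integer vector on the hyperplane *)

Section hyperplane_forms.
Context (R : realType) (m : nat) (a : m.+1.-tuple R).
Local Notation n := m.+1.

Definition form_coef (q : n.-tuple int) (j : 'I_m) : R :=
  (tnth q ord0)%:~R * linear_coef a j + (tnth q (lift ord0 j))%:~R.

Definition form_cst (q : n.-tuple int) : R :=
  (tnth q ord0)%:~R * tnth a ord_max.

Lemma dotR_hyperplane_param q x :
  dotR (int_vec R q) (hyperplane_param a x) =
  affine_form (form_coef q) (form_cst q) x.
Proof.
rewrite /dotR big_ord_recl tnth_mktuple /affine_form /form_cst /= tnth0 mulrDr.
rewrite -addrA [X in _ + X = _]addrC addrA; congr (_ + _).
rewrite mulr_sumr -big_split; apply: eq_bigr => j _ /=.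
by rewrite tnth_mktuple tnthS /form_coef mulrDl mulrA.
Qed.

Let s := #|[set i : 'I_m | linear_coef a i != 0]%SET|.+1.

(** The origin of the exponent [s]: the leading entry gives one factor [l], and each nonzero
    coefficient gives another. *)
Lemma prod_support (l : R) :
  l * \prod_(j < m) (if linear_coef a j != 0 then l else 1) = l ^+ s.
Proof.
rewrite exprS -big_mkcond; congr (_ * _).
by rewrite -prodr_const; apply: eq_bigl => j; rewrite inE.
Qed.

Lemma Pi_plus_int q : Pi_plus (int_vec R q) =
  Num.max 1 `|(tnth q ord0)%:~R| *
  \prod_(j < m) Num.max 1 `|(tnth q (lift ord0 j))%:~R|.
Proof.
rewrite /Pi_plus big_ord_recl tnth_mktuple; congr (_ * _).
by apply: eq_bigr => j _; rewrite tnth_mktuple.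
Qed.

(** Where the coefficient of [a] vanishes, the entry of [q] is an integer of absolute value below 1,
    hence 0. Elsewhere it is at most [l * |a_j| + 1], where [l] is the size of the leading entry. *)
Lemma Pi_plus_le : exists2 C : R, 0 < C & forall q,
  1 <= `|(tnth q ord0)%:~R : R| -> (forall j, `|form_coef q j| < 1) ->
  Pi_plus (int_vec R q) <= C * `|(tnth q ord0)%:~R| ^+ s.
Proof.
exists (\prod_(j < m) (`|linear_coef a j| + 1)).
  by apply: prodr_gt0 => j _; rewrite ltr_wpDl.
move=> q; set l := `|_| => l1 qj; rewrite Pi_plus_int -/l max_r//.
rewrite -prod_support mulrCA ler_wpM2l//; first by lra.
rewrite -big_split /=; apply: ler_prod => j _.
rewrite le_max ler01 /= ge_max; move: (qj j); rewrite /form_coef.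
case: eqP => [->|_] /=.
  by rewrite mulr0 add0r => /int_norm_lt1 ->; rewrite normr0 add0r mulr1 lexx ler01.
set k := (tnth q (lift ord0 j))%:~R => h.
have k1 : `|k| <= l * `|linear_coef a j| + 1.
  rewrite -normrM; have := ler_normB ((tnth q ord0)%:~R * linear_coef a j + k)
    ((tnth q ord0)%:~R * linear_coef a j); rewrite addrAC subrr add0r; lra.
have al : 0 <= `|linear_coef a j| by [].
apply/andP; split; last by nra.
by nra.
Qed.

(** For nonzero [a_j] the entry is at least [l * |a_j| - 1 / 2], hence at least half of [l * |a_j|]
    once this product exceeds 1; otherwise the maximum with 1 suffices. *)
Lemma Pi_plus_ge : exists2 C : R, 0 < C & forall q,
  1 <= `|(tnth q ord0)%:~R : R| -> (forall j, `|form_coef q j| < 1 / 2) ->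
  C * `|(tnth q ord0)%:~R| ^+ s <= Pi_plus (int_vec R q).
Proof.
exists (\prod_(j < m) (if linear_coef a j != 0 then `|linear_coef a j| / 2 else 1)).
  by apply: prodr_gt0 => j _; case: ifP => // aj; rewrite divr_gt0 ?normr_gt0.
move=> q; set l := `|_| => l1 qj; rewrite Pi_plus_int -/l max_r//.
rewrite -prod_support mulrCA ler_wpM2l//; first by lra.
rewrite -big_split /=; apply: ler_prod => j _.
move: (qj j); rewrite /form_coef.
case: ifP => [aj|_] /=; last by rewrite mulr1 ler01 le_max lexx.
set k := (tnth q (lift ord0 j))%:~R => h.
have al : 0 <= `|linear_coef a j| by [].
have k1 : l * `|linear_coef a j| - 1 / 2 <= `|k|.
  rewrite -normrM; have := ler_normB ((tnth q ord0)%:~R * linear_coef a j + k) k.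
  rewrite addrK; lra.
rewrite mulr_ge0 ?divr_ge0//=; last by lra.
rewrite le_max; case: (leP (l * `|linear_coef a j|) 1) => la.
  by apply/orP; left; lra.
by apply/orP; right; lra.
Qed.

Lemma affine_form_norm_le (c : 'I_m -> R) d x e : 0 <= e ->
  (forall j, `|c j| <= e) -> `|d| <= e ->
  `|affine_form c d x| <= e * (\sum_(i < m) `|tnth x i| + 1).
Proof.
move=> e0 ce de; rewrite /affine_form (le_trans (ler_normD _ _))// mulrDr mulr1.
rewrite lerD// (le_trans (ler_norm_sum _ _ _))// mulr_sumr ler_sum// => i _.
by rewrite normrM ler_wpM2r.
Qed.

(** A good approximation [(q0, p)] of [a] yields a form of size at most [C3 * l ^ (- v)] at [x],
    against a target of order [l ^ (- w * s)]. As [v] is larger than [w * s], every large [q0] is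
    the leading entry of a solution. *)
Lemma mult_exponent_of_simult (N : 'rV[R]_n -> R) (u v : R) x :
  is_norm N -> 0 <= u -> u / n%:R * s%:R < v ->
  infinite_set [set q : int | exists p : n.-tuple int,
      N (\row_i (q%:~R * tnth a i + (tnth p i)%:~R)) < `|q%:~R| `^ (- v)] ->
  infinite_set [set q : n.-tuple int | exists p : int,
      `|dotR (int_vec R q) (hyperplane_param a x) + p%:~R| <
         Pi_plus (int_vec R q) `^ (- (u / n%:R))].
Proof.
move=> hN u0 usv infS; set T := (X in infinite_set X) => finT; apply: infS.
have [C1 C10 NC1] := coord_le_is_norm hN.
have [C2 C20 PC2] := Pi_plus_le.
set w := u / n%:R in usv T finT *.
have w0 : 0 <= w by rewrite divr_ge0.
pose C3 := C1 * (\sum_(i < m) `|tnth x i| + 1).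
have sx0 : 0 <= \sum_(i < m) `|tnth x i| by exact: sumr_ge0.
have sw0 : 0 <= w * s%:R by rewrite mulr_ge0.
(* [L1] makes the power gain beat the constants; [L2] makes the linear coefficients less than 1, as
   [Pi_plus_le] requires. *)
have [||L1 L11 HL1] := @powRN_small R (v - w * s%:R) C3 (C2 `^ (- w)).
- lra.
- exact: powR_gt0.
have [||L2 L21 HL2] := @powRN_small R v C1 1; [lra|lra|].
pose L := Num.max L1 L2.
apply: (@sub_finite_set _ _ ((fun q : n.-tuple int => tnth q ord0) @` T `|`
   [set k : int | `|k%:~R : R| < L])); last first.
  by rewrite finite_setU; split; [exact: finite_image|exact: finite_int_norm_lt].
move=> q0 /= [p Np]; have [|Lq] := ltP `|q0%:~R : R| L; [by right|left].
set l := `|q0%:~R| in Np Lq.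
move: Lq; rewrite ge_max => /andP[/[dup] L1l /HL1 l1 /[dup] L2l /HL2 l2].
have l0 : 0 < l by lra.
pose q : n.-tuple int := [tuple of q0 :: [tuple tnth p (widen_ord (leqnSn m) j) | j < m]].
have q0E : tnth q ord0 = q0 by [].
exists q => //; exists (tnth p ord_max).
have rowE i : `|q0%:~R * tnth a i + (tnth p i)%:~R| <= C1 * l `^ (- v).
  have := NC1 (\row_i (q0%:~R * tnth a i + (tnth p i)%:~R)) i.
  rewrite mxE => /le_trans; apply.
  by rewrite ler_wpM2l// ltW.
have cfE j : `|form_coef q j| <= C1 * l `^ (- v).
  have := rowE (widen_ord (leqnSn m) j).
  by rewrite /form_coef q0E tnthS tnth_mktuple.
rewrite dotR_hyperplane_param.
have -> : affine_form (form_coef q) (form_cst q) x + (tnth p ord_max)%:~R =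
   affine_form (form_coef q) (form_cst q + (tnth p ord_max)%:~R) x.
  by rewrite /affine_form addrA.
apply: le_lt_trans (affine_form_norm_le _ _ cfE _) _.
- by rewrite mulr_ge0 ?powR_ge0// ltW.
- by rewrite /form_cst q0E; exact: rowE.
have Pl : Pi_plus (int_vec R q) <= C2 * l ^+ s.
  apply: PC2; first by rewrite q0E; apply: le_trans L1l.
  by move=> j; apply: le_lt_trans (cfE j) _.
have P1 := Pi_plus_ge1 (int_vec R q).
have ls0 : 0 < l ^+ s by exact: exprn_gt0.
apply: (@lt_le_trans _ _ ((C2 * l ^+ s) `^ (- w))); last first.
  rewrite !powRN lef_pV2 ?posrE ?powR_gt0 ?mulr_gt0//; last by lra.
  by apply: (ge0_ler_powR w0); rewrite ?nnegrE ?mulr_ge0//; lra.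
rewrite powRM ?ltW// -powR_mulrn ?(ltW l0)// -powRrM.
have -> : s%:R * - w = - (w * s%:R) by ring.
rewrite -(ltr_pM2r (powR_gt0 (w * s%:R) l0)) -[in X in _ < X]mulrA -powRD; last first.
  by rewrite (gt_eqF l0) implybT.
rewrite addNr powRr0 mulr1; apply: le_lt_trans l1.
rewrite /C3 mulrAC -[X in X <= _]mulrA [X in _ * X]mulrC.
have -> : - (v - w * s%:R) = - v + w * s%:R by ring.
rewrite [X in _ <= _ * X]powRD; last by rewrite (gt_eqF l0) implybT.
by rewrite [leLHS](_ : _ = C1 * (\sum_(i < m) `|tnth x i| + 1) * (l `^ (- v) * l `^ (w * s%:R))) //; ring.
Qed.

Lemma mult_exponent_hyperplane_ge (N : 'rV[R]_n -> R) x : is_norm N ->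
  ((n%:R / s%:R)%:E * simult_exponent N a <=
    mult_exponent (hyperplane_param a x))%E.
Proof.
move=> hN; have := mult_exponent_ge (hyperplane_param a x).
set om := mult_exponent _ => nom.
have ns0 : 0 < n%:R / s%:R :> R by rewrite divr_gt0 ?ltr0n.
rewrite muleC -lee_pdivlMr//.
apply: ge_ereal_sup => _ [v vS <-].
rewrite lee_pdivlMr// -EFinM.
move omE : om nom => [r||]; [|by move=> _; exact: leey|by []].
rewrite !lee_fin => nr; rewrite leNgt; apply/negP => rv.
(* A midpoint strictly above the finite exponent [r]; it is nonnegative because [r] is at least
   [n]. *)
pose u := (r + v * (n%:R / s%:R)) / 2.
have n1 : 1 <= n%:R :> R by rewrite ler1n.
have u0 : 0 <= u by rewrite /u; lra.
have : (u%:E <= om)%E.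
  apply: ereal_sup_ubound => /=; exists u => //=.
  apply: mult_exponent_of_simult vS => //.
  rewrite -ltr_pdivlMr ?ltr0n// ltr_pdivrMr ?ltr0n// /u.
  by have -> : v / s%:R * n%:R = v * (n%:R / s%:R) by [ring]; lra.
by rewrite omE lee_fin /u; lra.
Qed.

End hyperplane_forms.

(** * Upper bound *)

Lemma exprn_powR (R : realType) (x b : R) k : 0 <= x ->
  (x ^+ k) `^ b = (x `^ b) ^+ k.
Proof.
move=> x0; elim: k => [|k IH]; first by rewrite !expr0 powR1.
by rewrite !exprS powRM ?exprn_ge0// IH.
Qed.

(* The integer [q p' - q' p] equals [q (q' z + p') - q' (q z + p)], which has
   absolute value less than 1. *)
Lemma close_rationals_eq (R : realType) (z : R) (q p q' p' : int) :
  `|q%:~R * z + p%:~R| * `|q%:~R| < 1 / 4 ->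
  `|q'%:~R * z + p'%:~R| * `|q'%:~R| < 1 / 4 ->
  `|q%:~R : R| <= 2 * `|q'%:~R| -> `|q'%:~R : R| <= 2 * `|q%:~R| ->
  q%:~R * (q'%:~R * z + p'%:~R) = q'%:~R * (q%:~R * z + p%:~R).
Proof.
move=> h h' qq' q'q; apply/eqP; rewrite -subr_eq0; apply/eqP.
have -> : q%:~R * (q'%:~R * z + p'%:~R) - q'%:~R * (q%:~R * z + p%:~R) =
    (q * p' - q' * p)%:~R :> R by rewrite intrB !intrM; ring.
suff : `|(q * p' - q' * p)%:~R : R| < 1 by move/int_norm_lt1 => ->.
have -> : (q * p' - q' * p)%:~R =
    q%:~R * (q'%:~R * z + p'%:~R) - q'%:~R * (q%:~R * z + p%:~R) :> R.
  by rewrite intrB !intrM; ring.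
apply: le_lt_trans (ler_normB _ _) _; rewrite !normrM.
set A := `|q%:~R * z + _| in h *; set B := `|q'%:~R * z + _| in h' *.
have A0 : 0 <= A by exact: normr_ge0.
have B0 : 0 <= B by exact: normr_ge0.
have : `|q%:~R| * B <= 2 * `|q'%:~R| * B by rewrite ler_wpM2r.
have : `|q'%:~R| * A <= 2 * `|q%:~R| * A by rewrite ler_wpM2r.
lra.
Qed.

(** Small linear coefficients and a small value at one point of the box force a small constant
    term. *)
Lemma affine_form_cst_le (R : realType) m (c : 'I_m -> R) (d M B : R) x :
  0 <= B -> box M x -> (forall j, `|c j| <= B) ->
  `|d| <= `|affine_form c d x| + m%:R * M * B.
Proof.
move=> B0 Bx cB; rewrite /affine_form; set S := \sum_(i < m) _.
have SB : `|S| <= m%:R * M * B.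
  rewrite (_ : m%:R * M * B = \sum_(i < m) (B * M)); last first.
    by rewrite sumr_const card_ord -mulr_natr; ring.
  rewrite (le_trans (ler_norm_sum _ _ _))// ler_sum// => i _.
  by rewrite normrM ler_pM//; exact: Bx.
have {1}-> : d = (S + d) - S by ring.
by rewrite (le_trans (ler_normB _ _))// lerD2l.
Qed.

Section upper.
Context (R : realType) (m : nat) (a : m.+1.-tuple R).
Local Notation n := m.+1.
Let s := #|[set i : 'I_m | linear_coef a i != 0]%SET|.+1.
Local Notation lead q := (`|(tnth q ord0)%:~R : R|).

Definition near_form (q : n.-tuple int) := forall j, `|form_coef a q j| < 1 / 2.

(** Entries in the same place lie within 1/2 of the same real number, strictly, so they differ by an
    integer of absolute value below 1. *)
Lemma near_form_eq (q r : n.-tuple int) : near_form q -> near_form r ->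
  tnth q ord0 = tnth r ord0 -> q = r.
Proof.
move=> nq nr qr0; apply: eq_from_tnth => i.
case: (unliftP ord0 i) => [j ->|->//].
apply/eqP; rewrite -subr_eq0; apply/eqP/(@int_norm_lt1 R).
have := nq j; have := nr j; rewrite /form_coef qr0 intrB !ltr_norml.
move=> /andP[? ?] /andP[? ?]; apply/andP; split; lra.
Qed.

Lemma near_form_lead_neq0 (q : n.-tuple int) : near_form q ->
  q <> [tuple 0 | i < n] -> tnth q ord0 != 0.
Proof.
move=> nq q0; apply/eqP => q00; apply: q0; apply: near_form_eq => //.
- move=> j; rewrite /form_coef !tnth_mktuple mul0r add0r normr0; lra.
- by rewrite tnth_mktuple.
Qed.

Lemma lead_ge1 (q : n.-tuple int) : tnth q ord0 != 0 -> 1 <= lead q.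
Proof. by move=> q0; rewrite -intr_norm -[1]/(1%:~R) ler_int; lia. Qed.

Lemma finite_near_form (B : R) :
  finite_set [set q : n.-tuple int | near_form q /\ lead q < B].
Proof.
apply: (@sub_finite_set _ _ ((fun q : n.-tuple int => tnth q ord0) @^-1`
    [set k : int | `|k%:~R : R| < B] `&` near_form)).
  by move=> q [].
set A := _ `&` _.
have Ainj : {in A &, injective (fun q : n.-tuple int => tnth q ord0)}.
  move=> q r; rewrite !inE => -[_ nq] [_ nr]; exact: near_form_eq.
rewrite -(eq_finite_set (inj_card_eq Ainj)).
apply: (@sub_finite_set _ _ [set k : int | `|k%:~R : R| < B]).
  by move=> k [q [qB _] <-].
exact: finite_int_norm_lt.
Qed.

Lemma Pi_plus_powR n' (w : R) (q : n'.-tuple int) :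
  Pi_plus (int_vec R q) `^ (- w) =
  \prod_(i < n') (Num.max 1 `|(tnth q i)%:~R| `^ (- w)).
Proof.
rewrite /Pi_plus; under eq_bigr do rewrite tnth_mktuple.
suff [] : 0 <= \prod_(i < n') Num.max 1 `|(tnth q i)%:~R : R| /\
    (\prod_(i < n') Num.max 1 `|(tnth q i)%:~R : R|) `^ (- w) =
    \prod_(i < n') (Num.max 1 `|(tnth q i)%:~R| `^ (- w)) by [].
apply: (big_ind2 (fun x y => 0 <= x /\ x `^ (- w) = y)).
- by rewrite powR1.
- by move=> x1 x2 y1 y2 [x0 <-] [y0 <-]; rewrite mulr_ge0// powRM.
- by move=> i _; rewrite le_max ler01.
Qed.

Context (w : R).
Local Notation e := (w * s%:R).

Let s1 : 1 <= s%:R :> R. Proof. by rewrite ler1n. Qed.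

Lemma Pi_plus_powR_le : 0 <= w -> exists2 C : R, 0 < C & forall q,
  tnth q ord0 != 0 -> near_form q ->
  Pi_plus (int_vec R q) `^ (- w) <= C * lead q `^ (- e).
Proof.
move=> w0; have [C C0 HC] := Pi_plus_ge a; exists (C `^ (- w)); first exact: powR_gt0.
move=> q q0 nq; have l1 := lead_ge1 q0; have := HC q l1 nq => Cl.
have l0 : 0 < lead q by lra.
have -> : - e = s%:R * - w by ring.
rewrite powRrM powR_mulrn ?(ltW l0)// -powRM ?(ltW C0) ?exprn_ge0//.
have Cl0 : 0 < C * lead q ^+ s by rewrite mulr_gt0// exprn_gt0.
rewrite !powRN lef_pV2 ?posrE ?powR_gt0//; last exact: lt_le_trans Cl.
apply: (ge0_ler_powR w0) => //; rewrite nnegrE ltW//; exact: lt_le_trans Cl.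
Qed.

(** * Splitting the forms on a box into thick and thin ones *)

Context (M : R).

Definition form_event (q : n.-tuple int) : set (Rn R m) :=
  box M `&` affine_form (form_coef a q) (form_cst a q) @^-1`
    near_int (Pi_plus (int_vec R q) `^ (- w)).

Lemma measurable_form_event q : measurable (form_event q).
Proof. by apply: measurable_slab; exact: measurable_near_int. Qed.

(** Chosen so that linear coefficients below [(K * lead q)^-1] change the value on the box by less
    than [1 / (8 * lead q)]. *)
Let K : R := 8 * (m%:R * M + 1).

Let K_ge8 : 1 <= M -> 8 <= K.
Proof.
by move=> M1; have : 0 <= m%:R * M by [apply: mulr_ge0 => //; lra]; rewrite /K; lra.
Qed.

(** The forms treated one at a time, by a union over integers; the thin ones are grouped into dyadic
    blocks. The zero vector is neither. *)
Definition thick_form (q : n.-tuple int) :=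
  ~ near_form q \/ tnth q ord0 != 0 /\
    exists j, (K * lead q)^-1 <= `|form_coef a q j|.

Definition thin_form (q : n.-tuple int) :=
  tnth q ord0 != 0 /\ forall j, `|form_coef a q j| < (K * lead q)^-1.

Lemma thin_form_near q : 1 <= M -> thin_form q -> near_form q.
Proof.
move=> /K_ge8 K8 [q0 qj] j; have l1 := lead_ge1 q0; apply: lt_le_trans (qj j) _.
rewrite -[leRHS]invrK lef_pV2 ?posrE; [|by apply: mulr_gt0; lra|by lra].
rewrite invf_div divr1; apply: le_trans (_ : K <= _); first by lra.
by rewrite ler_peMr//; lra.
Qed.

Lemma near_form_dichotomy q : q <> [tuple 0 | i < n] ->
  thick_form q \/ thin_form q.
Proof.
move=> q0; have [nq|nq] := pselect (near_form q); last by left; left.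
have q00 := near_form_lead_neq0 nq q0.
have [qj|qj] := pselect (exists j, (K * lead q)^-1 <= `|form_coef a q j|).
  by left; right.
right; split => // j; rewrite ltNge; apply/negP => jq; apply: qj; by exists j.
Qed.

Lemma negligible_thick : 1 < w -> 1 <= M -> (lebesgue_Rn R m).-negligible
  [set x | infinite_set [set q | thick_form q /\ form_event q x]].
Proof.
move=> w1 M1; have K8 := K_ge8 M1.
pose A q : set (Rn R m) := if `[< thick_form q >] then form_event q else set0.
have mA q : measurable (A q).
  by rewrite /A; case: ifP => _; [exact: measurable_form_event|].
have w0 : 0 <= w by lra.
have [C C0 HC] := Pi_plus_powR_le w0.
pose D := (2 * M) ^+ m * (10 * M).
have D0 : 0 <= D by rewrite mulr_ge0 ?exprn_ge0//; lra.
have DCK0 : 0 <= D * C * (1 + K).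
  by apply: mulr_ge0; [apply: mulr_ge0 => //; exact: ltW|lra].
(* For [s = 1] no thick form is near: its linear coefficients would be integers below 1/2, not all
   zero. The value 2 then only keeps the majorant summable. *)
pose e2 : R := if (2 <= s)%N then e - 1 else 2.
have e21 : 1 < e2.
  rewrite /e2; case: ifP => [s2|_]; last by lra.
  have : 2 <= s%:R :> R by rewrite ler_nat.
  by nra.
pose P : pred (n.-tuple int) := fun q => `[< near_form q >].
have [Z1 HZ1] := sums_bounded_powR w1.
have [Z2 HZ2] := sums_bounded_powR e21.
have AE x : [set q | thick_form q /\ form_event q x] = [set q | A q x].
  apply/seteqP; split => q; rewrite /A /=; case: asboolP => [h|h] //.
  - by case.
  - by case=> /h.
have -> : [set x | infinite_set [set q | thick_form q /\ form_event q x]] =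
    [set x | infinite_set [set q | A q x]].
  by congr mkset; apply/funext => x; rewrite AE.
(* The first summand bounds the forms with a coefficient of size at least 1/2, where [1 + 1 / |c|]
   is at most 3. The second bounds the near thick forms, where [1 + 1 / |c|] is at most
   [(1 + K) * lead q]. *)
apply: (@borel_cantelli_countable _ _ _ _ _ _ (fun q =>
   3 * D * \prod_(i < n) (Num.max 1 `|(tnth q i)%:~R| `^ (- w)) +
   D * C * (1 + K) *
     (if P q then Num.max 1 `|(tnth q ord0)%:~R| `^ (- e2) else 0))) => //; last first.
  apply: sums_boundedD; apply: sums_boundedZ.
  - by rewrite mulr_ge0.
  - by apply: sums_bounded_tuple HZ1 => i; exact: powR_ge0.
  - exact: DCK0.
  - apply: (@sums_bounded_inj _ _ _ (fun q : n.-tuple int => tnth q ord0)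
      (fun k : int => Num.max 1 `|k%:~R| `^ (- e2)) Z2 P) => //.
    move=> q r; rewrite !unfold_in => /asboolP nq /asboolP nr.
    exact: near_form_eq.
move=> q; rewrite /A; case: asboolP => [Tq|_]; last first.
  rewrite measure0 lee_fin addr_ge0//.
    apply: mulr_ge0; first exact: mulr_ge0.
    by apply: prodr_ge0 => i _; exact: powR_ge0.
  by case: ifP => _; rewrite ?mulr0// mulr_ge0// powR_ge0.
rewrite -Pi_plus_powR; set eps := _ `^ (- w).
have eps0 : 0 <= eps by exact: powR_ge0.
have eps1 : eps <= 1.
  rewrite /eps -[leRHS](powRr0 (Pi_plus (int_vec R q))).
  by rewrite ler_powR ?Pi_plus_ge1//; lra.
have [nq|nq] := pselect (near_form q); last first.
  have [j jq] : exists j, 1 / 2 <= `|form_coef a q j|.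
    apply: contrapT => noj; apply: nq => j; rewrite ltNge; apply/negP => jq.
    by apply: noj; exists j.
  have cj0 : 0 < `|form_coef a q j| by lra.
  apply: (le_trans (near_int_slab_le (j := j) _ _ _ _)) => //.
  - by rewrite -normr_gt0.
  - by rewrite eps0.
  rewrite lee_fin.
  have cV : `|form_coef a q j|^-1 <= 2.
    by rewrite -[leRHS]invrK lef_pV2 ?posrE//; lra.
  apply: (@le_trans _ _ (3 * D * eps)).
    rewrite (_ : (2 * M) ^+ m * _ = D * eps * (1 + `|form_coef a q j|^-1)); last first.
      by rewrite /D /eps; ring.
    rewrite (_ : 3 * D * eps = D * eps * 3); last by ring.
    apply: ler_wpM2l; first exact: mulr_ge0.
    by lra.
  rewrite lerDl; case: ifP => _; last by rewrite mulr0.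
  by rewrite mulr_ge0// powR_ge0.
case: Tq => // -[q0 [j jq]].
have l1 := lead_ge1 q0.
have Kl0 : 0 < K * lead q by apply: mulr_gt0; lra.
have cj0 : 0 < `|form_coef a q j| by apply: lt_le_trans jq; rewrite invr_gt0.
have s2 : (2 <= s)%N.
  rewrite /s ltnS; apply/card_gt0P; exists j; rewrite inE; apply/eqP => aj.
  have := nq j; move: cj0; rewrite /form_coef aj mulr0 add0r => c0 c1.
  have : `|(tnth q (lift ord0 j))%:~R : R| < 1 by lra.
  by move/int_norm_lt1 => z; move: c0; rewrite z normr0 ltxx.
rewrite /P asboolT// /e2 s2 max_r//.
apply: (le_trans (near_int_slab_le (j := j) _ _ _ _)) => //.
- by rewrite -normr_gt0.
- by rewrite eps0.
rewrite lee_fin.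
have cV : `|form_coef a q j|^-1 <= K * lead q.
  by rewrite -[leRHS]invrK lef_pV2 ?posrE// invr_gt0.
apply: (@le_trans _ _ (D * C * (1 + K) * lead q `^ (- (e - 1)))); last first.
  by rewrite lerDr mulr_ge0// mulr_ge0.
rewrite (_ : (2 * M) ^+ m * _ = D * (eps * (1 + `|form_coef a q j|^-1))); last first.
  by rewrite /D /eps; ring.
have -> : - (e - 1) = - e + 1 by ring.
rewrite powRD ?powRr1; last 2 first.
- by lra.
- have l0 : 0 < lead q by lra.
  by rewrite (gt_eqF l0) implybT.
rewrite (_ : D * C * (1 + K) * _ =
   D * ((C * lead q `^ (- e)) * ((1 + K) * lead q))); last by ring.
apply: ler_wpM2l => //; apply: ler_pM => //; last by rewrite mulrDl mul1r lerD.
exact: HC.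
Qed.

Lemma simult_lower_bound (N : 'rV[R]_n -> R) (v : R) : is_norm N ->
  finite_set [set q : int | exists p : n.-tuple int,
      N (\row_i (q%:~R * tnth a i + (tnth p i)%:~R)) < `|q%:~R| `^ (- v)] ->
  exists2 c : R, 0 < c & exists L : R, forall (q : n.-tuple int) (p : int) B,
    L <= lead q -> (forall j, `|form_coef a q j| <= B) ->
    `|form_cst a q + p%:~R| <= B -> c * lead q `^ (- v) <= B.
Proof.
move=> hN /finite_seqP[t tE].
have [C C0 NC] := is_norm_le_coord hN.
exists C^-1; first by rewrite invr_gt0.
(* Beyond this bound the leading entry cannot lie in the finite exceptional set [t]. *)
exists (\sum_(k <- t) `|k%:~R| + 1) => q p B Lq qB pB.
rewrite ler_pdivrMl//.
(* In [a] the constant term comes last, so the entries of [q] after the leading one are followed by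
   [p]. *)
pose p' : n.-tuple int := [tuple if unlift ord_max i is Some j
  then tnth q (lift ord0 j) else p | i < n].
pose r : 'rV[R]_n := \row_i ((tnth q ord0)%:~R * tnth a i + (tnth p' i)%:~R).
apply: (@le_trans _ _ (N r)); last first.
  apply: NC => i; rewrite mxE tnth_mktuple.
  case: (unliftP ord_max i) => [j|] ->; last exact: pB.
  have := qB j; rewrite /form_coef /linear_coef.
  suff -> : widen_ord (leqnSn m) j = lift ord_max j by [].
  by apply: val_inj; rewrite [RHS]lift_max.
rewrite leNgt; apply/negP => Nr.
have : [set` t] (tnth q ord0) by rewrite -tE; exists p'.
move=> /= qt; move: Lq; apply/negP; rewrite -ltNge (big_rem _ qt) /=.
have : 0 <= \sum_(k <- rem (tnth q ord0) t) `|k%:~R : R| by exact: sumr_ge0.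
lra.
Qed.

Lemma lead_inv_gt0 (q : n.-tuple int) : 1 <= M -> tnth q ord0 != 0 -> 0 < (K * lead q)^-1.
Proof.
move=> /K_ge8 K8 /lead_ge1 l1; rewrite invr_gt0; apply: mulr_gt0; lra.
Qed.

Lemma thin_form_coef_lt q j : 1 <= M -> thin_form q ->
  `|form_coef a q j| * lead q < 1 / 4.
Proof.
move=> M1 [q0 qj]; have l1 := lead_ge1 q0; have K8 := K_ge8 M1.
have l0 : 0 < lead q by lra.
rewrite -ltr_pdivlMr//; apply: lt_le_trans (qj j) _.
by rewrite invfM ler_pM2r ?invr_gt0// div1r lef_pV2 ?posrE//; lra.
Qed.

(** The value at [x] contributes less than [2 * eps * T < 1 / 8], and the linear part less than
    [m * M / K < 1 / 8]. The bound 1/4 is the one that [close_rationals_eq] requires. *)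
Lemma thin_form_cst_lt q (d eps T : R) x : 1 <= M -> thin_form q ->
  lead q < 2 * T -> eps * T < 1 / 16 -> box M x ->
  `|affine_form (form_coef a q) d x| < eps -> `|d| * lead q < 1 / 4.
Proof.
move=> M1 [q0 qj] qT epsT Bx qx; have l1 := lead_ge1 q0; have K8 := K_ge8 M1.
have l0 : 0 < lead q by lra.
have eps0 : 0 < eps by exact: le_lt_trans qx.
have h := affine_form_cst_le d (ltW (lead_inv_gt0 M1 q0)) Bx
  (fun j => ltW (qj j)).
apply: le_lt_trans (ler_wpM2r (ltW l0) h) _; rewrite mulrDl.
have -> : m%:R * M * (K * lead q)^-1 * lead q = m%:R * M / K.
  by field; rewrite !gt_eqF//; lra.
have : m%:R * M / K < 1 / 8 by rewrite ltr_pdivrMr; [rewrite /K; lra|lra].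
have : `|affine_form (form_coef a q) d x| * lead q < eps * lead q.
  by rewrite ltr_pM2r.
have : eps * lead q < eps * (2 * T) by rewrite ltr_pM2l.
lra.
Qed.

Definition thin_hit (eps T : R) (q : n.-tuple int) (x : Rn R m) (p : int) :=
  [/\ thin_form q, T <= lead q < 2 * T, box M x &
   `|affine_form (form_coef a q) (form_cst a q + p%:~R) x| < eps].

(* All forms that hit the box in a dyadic block are proportional, so that one
   strip contains all their strips. *)
Lemma thin_hit_same_strip (eps T : R) q x p r y p' : 1 <= M -> eps * T < 1 / 16 ->
  thin_hit eps T q x p -> thin_hit eps T r y p' ->
  `|affine_form (form_coef a r) (form_cst a r + p'%:~R) x| < 2 * eps.
Proof.
move=> M1 epsT [tq /andP[Tq qT] Bx qx] [tr /andP[Tr rT] By ry].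
have sq := thin_form_cst_lt M1 tq qT epsT Bx qx.
have sr := thin_form_cst_lt M1 tr rT epsT By ry.
have lq0 : 0 < lead q by have [/lead_ge1] := tq; lra.
have eps0 : 0 < eps by exact: le_lt_trans qx.
have qr : lead q <= 2 * lead r by lra.
have rq : lead r <= 2 * lead q by lra.
have E : (tnth q ord0)%:~R * affine_form (form_coef a r) (form_cst a r + p'%:~R) x =
   (tnth r ord0)%:~R * affine_form (form_coef a q) (form_cst a q + p%:~R) x.
  rewrite /affine_form [LHS]mulrDr [RHS]mulrDr.
  rewrite (close_rationals_eq sq sr qr rq) !mulr_sumr; congr (_ + _).
  apply: eq_bigr => i _; rewrite !mulrA; congr (_ * _).
  exact: close_rationals_eq (thin_form_coef_lt i M1 tq) (thin_form_coef_lt i M1 tr) qr rq.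
have /(congr1 Num.norm) := E; rewrite !normrM => nE.
rewrite -(ltr_pM2l lq0) nE.
have lr0 : 0 < lead r by have [/lead_ge1] := tr; lra.
apply: (@lt_le_trans _ _ (lead r * eps)); first by rewrite ltr_pM2l.
by rewrite [leRHS]mulrCA [leRHS]mulrA (ler_pM2r eps0).
Qed.

(** If all linear coefficients were smaller, the constant term would be small too, against the lower
    bound for approximations of [a]. The factor [2 ^ (- v)] comes from [lead q < 2 * T]; half of the
    bound is left to [eps] and half to the coefficients. *)
Lemma thin_hit_coef_ge (c v eps T : R) q x p : 1 <= M -> 0 < c -> 0 < v ->
  0 < T -> thin_hit eps T q x p ->
  (forall B, (forall j, `|form_coef a q j| <= B) ->
    `|form_cst a q + p%:~R| <= B -> c * lead q `^ (- v) <= B) ->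
  eps < c * 2 `^ (- v) / 2 * T `^ (- v) ->
  exists j, c * 2 `^ (- v) / (2 * (m%:R * M + 1)) * T `^ (- v) <= `|form_coef a q j|.
Proof.
move=> M1 c0 v0 T0 [[q0 qj] /andP[Tq qT] Bx qx] cq epsT.
have mM0 : 0 <= m%:R * M by apply: mulr_ge0 => //; lra.
set c2 := c * _ / (2 * _).
have c2E : c2 * (m%:R * M + 1) = c * 2 `^ (- v) / 2.
  by rewrite /c2; field; rewrite gt_eqF//; lra.
have B0 : 0 <= c2 * T `^ (- v).
  apply: mulr_ge0; last exact: powR_ge0.
  by rewrite divr_ge0// ?mulr_ge0 ?powR_ge0 ?(ltW c0)//; lra.
apply: contrapT => noj.
have qB j : `|form_coef a q j| <= c2 * T `^ (- v).
  by rewrite leNgt; apply/negP => /ltW jr; apply: noj; exists j.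
have cstB := affine_form_cst_le (form_cst a q + p%:~R) B0 Bx qB.
have mMB : 0 <= m%:R * M * (c2 * T `^ (- v)) by exact: mulr_ge0.
have eps0 : 0 < eps by exact: le_lt_trans qx.
have : c * lead q `^ (- v) <= eps + (m%:R * M + 1) * (c2 * T `^ (- v)).
  apply: cq.
  - by move=> i; apply: le_trans (qB i) _; lra.
  - by apply: le_trans cstB _; lra.
have : c * (2 `^ (- v) * T `^ (- v)) <= c * lead q `^ (- v).
  have lq0 : 0 < lead q by lra.
  rewrite ler_pM2l// -powRM ?(ltW T0)// !powRN lef_pV2 ?posrE ?powR_gt0//; last lra.
  by apply: (ge0_ler_powR (ltW v0)); rewrite ?nnegrE//; lra.
have -> : (m%:R * M + 1) * (c2 * T `^ (- v)) = c * 2 `^ (- v) / 2 * T `^ (- v).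
  by rewrite mulrA [_ * c2]mulrC c2E.
lra.
Qed.

(** Once one form of the block hits the box, its strip of half-width [2 * eps] contains all the
    others. The width is of order [T ^ (- e)] and the largest coefficient at least of order
    [T ^ (- v)], whence the exponent [e - v]. *)
Lemma thin_block (C c v L : R) : 1 <= M -> 0 < C -> 0 < c ->
  0 < v -> v < e -> 1 < e ->
  (forall q, tnth q ord0 != 0 -> near_form q ->
    Pi_plus (int_vec R q) `^ (- w) <= C * lead q `^ (- e)) ->
  (forall (q : n.-tuple int) (p : int) B,
    L <= lead q -> (forall j, `|form_coef a q j| <= B) ->
    `|form_cst a q + p%:~R| <= B -> c * lead q `^ (- v) <= B) ->
  exists2 C' : R, 0 <= C' & exists L' : R, forall T, L' <= T ->
    exists D : set (Rn R m), [/\ measurable D,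
      (lebesgue_Rn R m D <= (C' * T `^ (- (e - v)))%:E)%E &
      forall q x, thin_form q -> form_event q x -> T <= lead q < 2 * T -> D x].
Proof.
move=> M1 C0 c0 v0 ve e1 PC cL.
have mM0 : 0 <= m%:R * M by apply: mulr_ge0 => //; lra.
pose c2 := c * 2 `^ (- v) / (2 * (m%:R * M + 1)).
have two_v : 0 < 2 `^ (- v) :> R by exact: powR_gt0.
have c20 : 0 < c2.
  by apply: divr_gt0; [exact: mulr_gt0|lra].
(* [L1] provides [eps * T < 1 / 16], for proportionality within the block; [L2] provides the
   smallness of [eps] that [thin_hit_coef_ge] asks for. *)
have [||L1 L11 HL1] := @powRN_small R (e - 1) C (1 / 16); [lra|lra|].
have [||L2 L21 HL2] := @powRN_small R (e - v) C (c * 2 `^ (- v) / 2).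
- lra.
- by apply: divr_gt0 => //; exact: mulr_gt0.
have M2 : 0 <= (2 * M) ^+ m by apply: exprn_ge0; lra.
have C4 : 0 <= 4 * C / c2 by apply: divr_ge0; [lra|exact: ltW].
have C'0 : 0 <= (2 * M) ^+ m * (4 * C / c2) by exact: mulr_ge0.
exists ((2 * M) ^+ m * (4 * C / c2)) => //.
exists (Num.max L (Num.max L1 L2)) => T.
rewrite !ge_max => /and3P[LT /[dup] L1T /HL1 T1 /HL2 T2].
have T0 : 0 < T by lra.
have Tne : T != 0 by rewrite gt_eqF.
(* A common bound for [Pi_plus (int_vec R q) ^ (- w)] over the near forms with [T <= lead q]. *)
pose eps := C * T `^ (- e).
have eps0 : 0 < eps by apply: mulr_gt0 => //; exact: powR_gt0.
have eps1 : eps * T < 1 / 16.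
  move: T1; rewrite (_ : - (e - 1) = - e + 1); last by ring.
  rewrite powRD ?powRr1 ?(ltW T0)//; last by rewrite Tne implybT.
  by rewrite mulrA.
have eps2 : eps < c * 2 `^ (- v) / 2 * T `^ (- v).
  move: T2; rewrite (_ : - (e - v) = - e + v); last by ring.
  rewrite powRD; last by rewrite Tne implybT.
  by rewrite mulrA -ltr_pdivlMr ?powR_gt0// -powRN.
have hitP q x : thin_form q -> form_event q x -> T <= lead q < 2 * T ->
    exists p, thin_hit eps T q x p.
  move=> tq [Bx [p qp]] Tq; exists p; split => //.
  have [q0 _] := tq; have nq := thin_form_near M1 tq.
  move: qp; rewrite /affine_form -addrA => /lt_le_trans; apply.
  apply: le_trans (PC q q0 nq) _; rewrite /eps ler_pM2l// !powRN.
  have e0 : 0 <= e by exact: le_trans ler01 (ltW e1).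
  have /andP[Tq1 _] := Tq; have l0 := lt_le_trans T0 Tq1.
  rewrite lef_pV2 ?posrE ?powR_gt0//.
  by apply: (ge0_ler_powR e0); rewrite ?nnegrE ?(ltW T0) ?(ltW l0).
have [[r [y [p' hr]]]|nohit] := pselect (exists r y p', thin_hit eps T r y p'); last first.
  exists set0; split => //.
    by rewrite measure0 lee_fin; apply: mulr_ge0 => //; exact: powR_ge0.
  move=> q x tq eq Tq; have [p hq] := hitP q x tq eq Tq.
  by apply: nohit; exists q, x, p.
have Lr : L <= lead r by have [_ /andP[Tr _] _ _] := hr; exact: le_trans Tr.
have [j jr] := thin_hit_coef_ge M1 c0 v0 T0 hr (fun B => cL r p' B Lr) eps2.
have Tv0 : 0 < T `^ (- v) by exact: powR_gt0.
have crj0 : 0 < `|form_coef a r j|.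
  by apply: lt_le_trans jr; exact: mulr_gt0.
exists (box M `&` affine_form (form_coef a r) (form_cst a r + p'%:~R) @^-1`
   [set u | `|u| < 2 * eps]); split.
- by apply: measurable_slab; exact: measurable_norm_lt.
- apply: (le_trans (strip_slab_le (j := j) _ _ _ _)) => //.
  + by rewrite -normr_gt0.
  + by apply: mulr_ge0 => //; exact: ltW.
  rewrite lee_fin -[leRHS]mulrA; apply: ler_wpM2l => //.
  rewrite ler_pdivrMr//.
  apply: (@le_trans _ _ (4 * C / c2 * T `^ (- (e - v)) * (c2 * T `^ (- v)))); last first.
    by apply: ler_wpM2l => //; apply: mulr_ge0 => //; exact: powR_ge0.
  rewrite (_ : - (e - v) = - e + v); last by ring.
  rewrite powRD; last by rewrite Tne implybT.
  rewrite [T `^ (- v)]powRN /eps.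
  have Tv : T `^ v != 0 by rewrite gt_eqF// powR_gt0.
  have c2n : c2 != 0 by rewrite gt_eqF.
  by rewrite [leRHS](_ : _ = 2 * (2 * (C * T `^ (- e))))//; field; rewrite Tv c2n.
move=> q x tq eq Tq; have [p hq] := hitP q x tq eq Tq.
split; first by have [] := hq.
exact: thin_hit_same_strip M1 eps1 hq hr.
Qed.

(** Borel-Cantelli is applied to the dyadic blocks and not to single forms. A point in only finitely
    many block sets meets only finitely many thin forms, because near forms with bounded leading
    entry are finite in number. *)
Lemma negligible_thin (N : 'rV[R]_n -> R) (v : R) : is_norm N ->
  1 <= M -> 1 < w -> 0 < v -> v < e ->
  finite_set [set q : int | exists p : n.-tuple int,
      N (\row_i (q%:~R * tnth a i + (tnth p i)%:~R)) < `|q%:~R| `^ (- v)] ->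
  (lebesgue_Rn R m).-negligible
    [set x | infinite_set [set q | thin_form q /\ form_event q x]].
Proof.
move=> hN M1 w1 v0 ve finN.
have w0 : 0 <= w by lra.
have e1 : 1 < e by have := ler_wpM2l w0 s1; lra.
have [C C0 HC] := Pi_plus_powR_le w0.
have [c c0 [L HL]] := simult_lower_bound hN finN.
have [C' C'0 [L' HL']] := thin_block M1 C0 c0 v0 ve e1 HC HL.
(* Blocks up to [k0] may lie below the threshold [L']; they get the empty set, as they contain
   finitely many thin forms. *)
pose k0 := Num.truncn L'.
have two_ge k : (k0 < k)%N -> L' <= 2 ^+ k.
  move=> kk; apply/ltW/(lt_le_trans (truncnS_gt L')).
  apply: le_trans (_ : k%:R <= _); first by rewrite ler_nat.
  by rewrite -natrX ler_nat ltnW// ltn_expl.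
have two_gt0 k : 0 < 2 ^+ k :> R by exact: exprn_gt0.
pose r : R := 2 `^ (- (e - v)).
have rE k : (2 ^+ k) `^ (- (e - v)) = r ^+ k.
  exact: exprn_powR.
have r01 : 0 <= r < 1.
  rewrite powR_ge0 /r powRN invf_lt1 ?powR_gt0//= -[ltLHS](powRr0 (2 : R)).
  by rewrite /powR !gt_eqF// ltr_expR ltr_pM2r ?ln_gt0//; lra.
have /choice[F FP] : forall k, exists D : set (Rn R m), [/\ measurable D,
    (lebesgue_Rn R m D <= (C' * r ^+ k)%:E)%E &
    (k0 < k)%N -> forall q x, thin_form q -> form_event q x ->
      2 ^+ k <= lead q < 2 ^+ k.+1 -> D x].
  move=> k; have [kk|kk] := ltnP k0 k.
    have [D [mD muD PD]] := HL' _ (two_ge k kk); exists D; split => //.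
      by rewrite -rE.
    by move=> _ q x tq eq; rewrite exprS; exact: PD.
  exists set0; split => //; rewrite measure0 lee_fin mulr_ge0// exprn_ge0//.
  by case/andP: r01.
apply: (@negligibleS _ _ _ _ [set x | infinite_set [set k | F k x]]); last first.
  apply: (@borel_cantelli_countable _ _ _ _ _ F (fun k => C' * r ^+ k)).
  - by move=> k; have [] := FP k.
  - by move=> k; have [] := FP k.
  - by apply: sums_boundedZ => //; exact: sums_bounded_geometric.
move=> x /= infq finF; apply: infq.
have /finite_seqP[t tE] := finF.
pose k1 := (maxn k0 (\max_(k <- t) k)).+1.
apply: sub_finite_set (finite_near_form (2 ^+ k1)).
move=> q [tq eq]; split; first exact: thin_form_near.
have [q0 _] := tq.
rewrite ltNge; apply/negP => qk.
pose k := trunc_log 2 `|tnth q ord0|.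
have aq : lead q = `|tnth q ord0|%N%:R by rewrite natr_absz intr_norm.
have aq0 : (0 < `|tnth q ord0|)%N by rewrite absz_gt0.
have /andP[k_le k_gt] := trunc_log_bounds (leqnn 2) aq0.
have kq : 2 ^+ k <= lead q < 2 ^+ k.+1.
  by rewrite aq -!natrX ler_nat ltr_nat k_le.
have k1k : (k1 <= k)%N.
  have : (2 ^ k1 < 2 ^ k.+1)%N.
    by rewrite -(ltr_nat R) !natrX; apply: le_lt_trans qk _; case/andP: kq.
  by rewrite ltn_exp2l.
have [_ _ Fk] := FP k.
have kk0 : (k0 < k)%N by apply: leq_trans k1k; rewrite ltnS leq_maxl.
have : [set` t] k by rewrite -tE; exact: Fk kk0 q x tq eq kq.
move=> /= kt; move: k1k; apply/negP; rewrite -ltnNge /k1 ltnS.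
by apply: leq_trans (leq_maxr _ _); exact: leq_bigmax_seq.
Qed.

End upper.

Lemma ereal_between (R : realType) (x y : \bar R) : (x < y)%E ->
  exists v : R, (x < v%:E < y)%E.
Proof.
case: x y => [x| |] [y| |] //.
- rewrite lte_fin => xy; exists ((x + y) / 2); rewrite !lte_fin.
  by apply/andP; split; lra.
- by exists (x + 1); rewrite lte_fin ltry andbT; lra.
- by exists (y - 1); rewrite lte_fin ltNyr; lra.
- by exists 0; rewrite ltNyr ltry.
Qed.

(** * From boxes to the whole hyperplane, and superlevel sets of the exponent *)

Section null_limsup.
Context (R : realType) (m : nat) (a : m.+1.-tuple R).
Local Notation n := m.+1.
Let s := #|[set i : 'I_m | linear_coef a i != 0]%SET|.+1.

Definition approximable (w : R) (x : Rn R m) (q : n.-tuple int) :=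
  exists p : int, `|dotR (int_vec R q) (hyperplane_param a x) + p%:~R| <
    Pi_plus (int_vec R q) `^ (- w).

Lemma measurable_approximable w q : measurable [set x | approximable w x q].
Proof.
rewrite (_ : mkset _ = affine_form (form_coef a q) (form_cst a q) @^-1`
    near_int (Pi_plus (int_vec R q) `^ (- w))).
  rewrite -[X in measurable X]setTI.
  exact: measurable_affine_form (measurable_near_int _).
by apply/seteqP; split => x [p]; rewrite ?dotR_hyperplane_param => xp;
  exists p; rewrite ?dotR_hyperplane_param.
Qed.

Lemma negligible_approximable (N : 'rV[R]_n -> R) (v w : R) : is_norm N ->
  1 < w -> 0 < v -> v < w * s%:R ->
  finite_set [set q : int | exists p : n.-tuple int,
      N (\row_i (q%:~R * tnth a i + (tnth p i)%:~R)) < `|q%:~R| `^ (- v)] ->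
  (lebesgue_Rn R m).-negligible [set x | infinite_set (approximable w x)].
Proof.
move=> hN w1 v0 vw finN.
pose U k : set (Rn R m) :=
  [set x | infinite_set [set q | thick_form a k.+1%:R q /\ form_event a w k.+1%:R q x]] `|`
  [set x | infinite_set [set q | thin_form a k.+1%:R q /\ form_event a w k.+1%:R q x]].
apply: (@negligibleS _ _ _ _ (\bigcup_k U k)); last first.
  apply: negligible_bigcup => k; have k1 : 1 <= k.+1%:R :> R by rewrite ler1n.
  apply: negligibleU; first exact: negligible_thick.
  exact: negligible_thin hN k1 w1 v0 vw finN.
move=> x /= infx; pose k := Num.truncn (\sum_(i < m) `|tnth x i|).
have xk : box k.+1%:R x.
  move=> i; apply: le_trans (ltW (truncnS_gt _)).
  by rewrite (bigD1 i)//= lerDl sumr_ge0.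
exists k => //; rewrite /U /=; apply: contrapT => /not_orP[].
move=> /contrapT fin1 /contrapT fin2; apply: infx.
apply: (@sub_finite_set _ _ ([set [tuple 0 | i < n]] `|`
  ([set q | thick_form a k.+1%:R q /\ form_event a w k.+1%:R q x] `|`
   [set q | thin_form a k.+1%:R q /\ form_event a w k.+1%:R q x]))); last first.
  by rewrite !finite_setU; split => //; exact: finite_set1.
move=> q [p]; rewrite dotR_hyperplane_param => qp.
have eq : form_event a w k.+1%:R q x by split => //; exists p.
have [->|q0] := pselect (q = [tuple 0 | i < n]); first by left.
by right; have [h|h] := near_form_dichotomy a k.+1%:R q0; [left|right].
Qed.

(** Since [Pi_plus] is at least 1, the admissible exponents are closed downwards, and a countable
    family of exponents above [v] suffices. This makes the superlevel set a countable union of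
    measurable limsup sets. *)
Lemma mult_exponent_gt (v : R) (y : n.-tuple R) :
  (v%:E < mult_exponent y)%E <->
  exists k : nat, infinite_set [set q : n.-tuple int | exists p : int,
    `|dotR (int_vec R q) y + p%:~R| <
      Pi_plus (int_vec R q) `^ (- ((v + k.+1%:R^-1) / n%:R))].
Proof.
split.
  move=> /ereal_sup_gt[_ [u uS <-]]; rewrite lte_fin => vu.
  have uv : 0 < u - v by rewrite subr_gt0.
  pose k := Num.truncn (u - v)^-1; exists k => fin; apply: uS.
  apply: sub_finite_set fin => q [p qp]; exists p.
  apply: lt_le_trans qp _; apply: ler_powR; first exact: Pi_plus_ge1.
  rewrite lerN2 ler_pM2r ?invr_gt0 ?ltr0n//.
  have : k.+1%:R^-1 <= u - v.
    rewrite -[leRHS]invrK lef_pV2 ?posrE ?invr_gt0 ?ltr0n//.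
    exact/ltW/truncnS_gt.
  by rewrite lerBrDl.
move=> [k infk]; apply: (@lt_le_trans _ _ (v + k.+1%:R^-1)%:E).
  by rewrite lte_fin ltrDl invr_gt0 ltr0n.
by apply: ereal_sup_ubound; exists (v + k.+1%:R^-1).
Qed.

Lemma hyperplane_lebesgue_mult_exponent_gt (N : 'rV[R]_n -> R) (v : R) :
  is_norm N -> n%:R < v ->
  ((n%:R / s%:R)%:E * simult_exponent N a < v%:E)%E ->
  hyperplane_lebesgue a [set y | (v%:E < mult_exponent y)%E] = 0.
Proof.
move=> hN nv sv.
have n0 : 0 < n%:R :> R by rewrite ltr0n.
have s0 : 0 < s%:R :> R by rewrite ltr0n.
pose w := v / n%:R.
have w1 : 1 < w by rewrite ltr_pdivlMr// mul1r.
have we : w * s%:R = v / (n%:R / s%:R) by rewrite /w; field; rewrite !gt_eqF.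
have sig : (simult_exponent N a < (w * s%:R)%:E)%E.
  by rewrite we EFinM lte_pdivlMr ?divr_gt0// muleC.
have e0 : 0 < w * s%:R by rewrite mulr_gt0//; lra.
(* A real exponent strictly between the simultaneous exponent and [w * s], kept positive even if the
   former is negative. *)
have [u [u0 ue su]] : exists u : R, [/\ 0 < u, u < w * s%:R & (simult_exponent N a < u%:E)%E].
  move: sig; case: simult_exponent => [r| |]; [|by []|]; last first.
    by move=> _; exists (w * s%:R / 2); split => //; [lra|lra|exact: ltNyr].
  rewrite lte_fin => re.
  exists ((Num.max 0 r + w * s%:R) / 2).
  have : Num.max 0 r < w * s%:R by rewrite gt_max e0.
  have : 0 <= Num.max 0 r by rewrite le_max lexx.
  have : r <= Num.max 0 r by rewrite le_max lexx orbT.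
  by rewrite lte_fin; split; lra.
have finN : finite_set [set q : int | exists p : n.-tuple int,
      N (\row_i (q%:~R * tnth a i + (tnth p i)%:~R)) < `|q%:~R| `^ (- u)].
  apply: contrapT => infN; move: su; apply/negP; rewrite -leNgt.
  by apply: ereal_sup_ubound; exists u.
have E : hyperplane_param a @^-1` [set y | (v%:E < mult_exponent y)%E] =
    \bigcup_k [set x | infinite_set (approximable ((v + k.+1%:R^-1) / n%:R) x)].
  apply/seteqP; split => x /=; first by move=> /mult_exponent_gt[k]; exists k.
  by move=> [k _ xk]; apply/mult_exponent_gt; exists k.
change (lebesgue_Rn R m (hyperplane_param a @^-1`
   [set y | (v%:E < mult_exponent y)%E]) = 0).
rewrite E; apply/negligibleP.
  apply: bigcup_measurable => k _.
  by apply: measurable_infinite_set => q; exact: measurable_approximable.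
apply: negligible_bigcup => k.
have k0 : 0 < k.+1%:R^-1 :> R by rewrite invr_gt0 ltr0n.
have wk : w < (v + k.+1%:R^-1) / n%:R by rewrite ltr_pM2r ?invr_gt0// ltrDl.
apply: (negligible_approximable hN _ u0 _ finN); first exact: lt_trans wk.
by apply: lt_trans ue _; rewrite ltr_pM2r.
Qed.

Lemma lebesgue_Rn_setT_gt0 : (0 < lebesgue_Rn R m setT)%E.
Proof.
apply: (@lt_le_trans _ _ (lebesgue_Rn R m (box 1))).
  by rewrite lebesgue_box// lte_fin exprn_gt0.
by apply: le_measure; rewrite ?inE//; exact: measurable_box.
Qed.

(** Both lower bounds hold at every point of the hyperplane, so the superlevel set has full
    preimage. *)
Lemma hyperplane_lebesgue_mult_exponent_gt0 (N : 'rV[R]_n -> R) (v : R) :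
  is_norm N ->
  (v%:E < maxe n%:R%:E ((n%:R / s%:R)%:E * simult_exponent N a))%E ->
  (0 < hyperplane_lebesgue a [set y | (v%:E < mult_exponent y)%E])%E.
Proof.
move=> hN vmax.
change (0 < lebesgue_Rn R m (hyperplane_param a @^-1`
  [set y | (v%:E < mult_exponent y)%E]))%E.
rewrite (_ : _ @^-1` _ = setT); first exact: lebesgue_Rn_setT_gt0.
apply/seteqP; split => // x _ /=; apply: lt_le_trans vmax _.
by rewrite ge_max mult_exponent_ge mult_exponent_hyperplane_ge.
Qed.

End null_limsup.

Local Close Scope classical_set_scope.

Theorem theorem1p4 (R : realType) (m : nat) (a : m.+1.-tuple R)
    (N : 'rV[R]_m.+1 -> R) (hN : is_norm N)
    (s : nat) (hs : s = #|[set i : 'I_m | linear_coef a i != 0]|.+1) :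
  hyperplane_mult_exponent a =
    maxe (m.+1%:R)%:E ((m.+1%:R / s%:R)%:E * simult_exponent N a)%E.
Proof.
subst s; set s := #|_|.+1; apply/eqP; rewrite eq_le; apply/andP; split.
  apply: ge_ereal_sup => _ [v /= v0 <-]; rewrite leNgt; apply/negP.
  rewrite gt_max => /andP[nv sv]; move: v0.
  by rewrite (hyperplane_lebesgue_mult_exponent_gt hN nv sv) ltxx.
rewrite leNgt; apply/negP => /ereal_between[v /andP[v1 v2]].
have : (v%:E <= hyperplane_mult_exponent a)%E.
  apply: ereal_sup_ubound; exists v => //=.
  exact: hyperplane_lebesgue_mult_exponent_gt0 hN v2.
by rewrite leNgt v1.
Qed.
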